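(* Let $\lambda\in\mathbb{C}\setminus\mathbb{Z}$ and $t\in\mathbb{C}\setminus\{0\}$. In the Lie superalgebra (with supercommutator) of polynomial differential operators on $\mathbb{C}[x,\theta]$ with $x$ even and $\theta$ odd, consider the odd operator $X=x\partial_\theta+x\theta\partial_x-\lambda\theta$, the even operator $Y=\partial_x$, and the odd operator $Z=t(\partial_x\partial_\theta-\theta\partial_x^2)$, and let $\mathfrak{osp}(\lambda+1|\lambda)$ be the Lie subsuperalgebra they generate. Let $\mathfrak F$ be the free Lie superalgebra on an odd generator $X$, an even generator $Y$ and an odd generator $Z$, and put $Y_i=(\operatorname{ad}X)^iY$, $Z_i=(\operatorname{ad}X)^iZ$. Then the natural homomorphism $\mathfrak F\to\mathfrak{osp}(\lambda+1|\lambda)$ is surjective and its kernel is the ideal generated by: (0.1) $[Y,Y_1]=0$; (0.2) $[Y_2,Y]=2Y$; (0.3) $[Y_2,X]=-X$; (1.1) $[Y,Z]=0$; (1.2) $[[X,Y],Z]=0$; (1.3) $(\operatorname{ad}X)^7Z=0$; (1.4) $[Y_2,Z]=3Z$; (2.1) $3[Z,Z_3]+2[Z_1,Z_2]=6t(2\lambda+1)\,Z$; (2.2) $[Z_1,Z_3]=2t^2(\lambda-1)(\lambda+2)\,Y+2t(2\lambda+1)\,Z_1$; (3.1) $[Z_1,[Z,Z]]=0$.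
   Context: All brackets are supercommutators $[a,b]=ab-(-1)^{p(a)p(b)}ba$ (so for odd $a$, $[a,a]=2a^2$), and $\operatorname{ad}X(w)=[X,w]$. $X$ is the image of the odd generator $\nabla^+$ of a superprincipally embedded $\mathfrak{osp}(1|2)$; $Z$ is a lowest weight vector (weight $-3$) of an irreducible $\mathfrak{osp}(1|2)$-submodule with odd highest weight vector of highest weight $3$ (dimension 7). Relation (1.3) expresses that this module is 7-dimensional. *)

(* Defs.v *)
From HB Require Import structures.
From mathcomp Require Import all_boot all_order all_algebra.
From mathcomp Require Import complex.
From mathcomp Require Import reals.
Set Implicit Arguments. Unset Strict Implicit. Unset Printing Implicit Defensive.
Import Order.TTheory GRing.Theory Num.Theory.
Local Open Scope ring_scope.
Local Open Scope complex_scope.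

Inductive gen := gX | gY | gZ.

Inductive tree := Gen of gen | Br of tree & tree.

Definition gen_eqb (a b : gen) : bool :=
  match a, b with gX, gX | gY, gY | gZ, gZ => true | _, _ => false end.

Fixpoint tree_eqb (s t : tree) : bool :=
  match s, t with
  | Gen a, Gen b => gen_eqb a b
  | Br s1 s2, Br t1 t2 => tree_eqb s1 t1 && tree_eqb s2 t2
  | _, _ => false
  end.

(* parity: true = odd *)
Definition gpar (g : gen) : bool := match g with gY => false | _ => true end.
Fixpoint par (s : tree) : bool :=
  match s with Gen g => gpar g | Br a b => par a (+) par b end.

Definition adX (n : nat) (s : tree) : tree := iter n (Br (Gen gX)) s.

Section FreeAlg.
Variable K : fieldType.

(* formal linear combinations  sum c_i . t_i  of bracket monomials *)
Definition fa := seq (K * tree).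
Definition coef (u : fa) (t : tree) : K := \sum_(p <- u | tree_eqb p.2 t) p.1.
Definition tm (t : tree) : fa := [:: (1, t)].
Definition fscale (c : K) (u : fa) : fa := [seq (c * p.1, p.2) | p <- u].
Definition fadd (u v : fa) : fa := u ++ v.
Definition fsub (u v : fa) : fa := u ++ fscale (-1) v.
Definition fbr (u v : fa) : fa := [seq (p.1 * q.1, Br p.2 q.2) | p <- u, q <- v].

Definition sgn (a b : tree) : K := if par a && par b then -1 else 1.

Definition antisym (a b : tree) : fa :=
  fadd (fbr (tm a) (tm b)) (fscale (sgn a b) (fbr (tm b) (tm a))).
Definition jacobi (a b c : tree) : fa :=
  fsub (fsub (fbr (tm a) (fbr (tm b) (tm c))) (fbr (fbr (tm a) (tm b)) (tm c)))
       (fscale (sgn a b) (fbr (tm b) (fbr (tm a) (tm c)))).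

Definition tX := Gen gX.
Definition tY := Gen gY.
Definition tZ := Gen gZ.
Definition Yi (i : nat) := adX i tY.
Definition Zi (i : nat) := adX i tZ.
Definition br2 (a b : tree) : fa := tm (Br a b).

Definition relators (lam t : K) : seq fa :=
  [:: br2 tY (Yi 1);
      fsub (br2 (Yi 2) tY) (fscale 2 (tm tY));
      fadd (br2 (Yi 2) tX) (tm tX);
      br2 tY tZ;
      br2 (Br tX tY) tZ;
      tm (Zi 7);
      fsub (br2 (Yi 2) tZ) (fscale 3 (tm tZ));
      fsub (fadd (fscale 3 (br2 tZ (Zi 3))) (fscale 2 (br2 (Zi 1) (Zi 2))))
           (fscale (6 * t * (2 * lam + 1)) (tm tZ));
      fsub (fsub (br2 (Zi 1) (Zi 3))
                 (fscale (2 * t ^+ 2 * (lam - 1) * (lam + 2)) (tm tY)))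
           (fscale (2 * t * (2 * lam + 1)) (tm (Zi 1)));
      br2 (Zi 1) (Br tZ tZ)
  ].

(* Two-sided ideal of the free nonassociative algebra generated by the
   super-Lie axioms and the relators.  Its image in the free Lie superalgebra
   (= free nonassociative algebra / ideal of super-Lie axioms) is exactly the
   ideal generated by the relators, and membership is up to formal equality
   of linear combinations (I_ext). *)
Inductive InI (lam t : K) : fa -> Prop :=
  | I_antisym a b : InI lam t (antisym a b)
  | I_jacobi a b c : InI lam t (jacobi a b c)
  | I_rel i : (i < size (relators lam t))%N -> InI lam t (nth [::] (relators lam t) i)
  | I_add u v : InI lam t u -> InI lam t v -> InI lam t (fadd u v)
  | I_scale c u : InI lam t u -> InI lam t (fscale c u)
  | I_left s u : InI lam t u -> InI lam t (fbr (tm s) u)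
  | I_right s u : InI lam t u -> InI lam t (fbr u (tm s))
  | I_ext u v : InI lam t u -> (forall s, coef u s = coef v s) -> InI lam t v.

(* an element f0 + f1*theta of K[x,theta] is the pair (f0, f1) *)
Definition V := ({poly K} * {poly K})%type.
Definition vzero : V := (0, 0).
Definition vadd (v w : V) : V := (v.1 + w.1, v.2 + w.2).
Definition vscale (c : K) (v : V) : V := (c *: v.1, c *: v.2).
Definition vsub (v w : V) : V := vadd v (vscale (-1) w).

(* X = x d_theta + x theta d_x - lam theta *)
Definition opX (lam : K) (v : V) : V := ('X * v.2, 'X * v.1^`() - lam *: v.1).
Definition opY (v : V) : V := (v.1^`(), v.2^`()).
(* Z = t (d_x d_theta - theta d_x^2) *)
Definition opZ (t : K) (v : V) : V := (t *: v.2^`(), - (t *: (v.1^`())^`())).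

Definition opgen (lam t : K) (g : gen) : V -> V :=
  match g with gX => opX lam | gY => opY | gZ => opZ t end.

Fixpoint ev (lam t : K) (s : tree) : V -> V :=
  match s with
  | Gen g => opgen lam t g
  | Br a b => fun v =>
      vsub (ev lam t a (ev lam t b v)) (vscale (sgn a b) (ev lam t b (ev lam t a v)))
  end.

Definition evl (lam t : K) (u : fa) (v : V) : V :=
  foldr (fun p acc => vadd (vscale p.1 (ev lam t p.2 v)) acc) vzero u.

End FreeAlg.

(* Main.v *)
(* Let L be the quotient of the free algebra by InI, acted on by the bracket
   operators [ad s].  The lowest weight vectors v_0 = Y, v_{m+1} = [Z_2, v_m] (m
   even), v_{m+1} = [Z, v_m] (m odd) have weights -2, -3, -6, -7, -10, -11, ...
   The elements (ad X)^n v_m span L: the only nontrivial point is that each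
   [Z_i, v_m] is such a combination.  Applying (2.1), (2.2) and their
   X-derivatives to v_m gives one linear equation for every [Z_i, v_{m+1}] with
   i > 0 (m even), resp. i > 2 (m odd), whose leading coefficient is a nonzero
   rational function of the weight; the remaining equations
   [Z, v_m] = [Z_1, v_m] = 0 for m even come from (3.1).
   By (1.3) ad X is locally nilpotent, hence (ad X)^n v_m = 0 for n > 2k
   if v_m has weight -k.  Finally v_m acts on K[x,theta] as a nonzero
   multiple of a power of d_theta - theta d_x, and these powers are linearly
   independent; applying ad [X,Y] often enough to an element of the kernel of
   the evaluation isolates its top coefficients, which therefore vanish. *)
Require Import Defs.
From HB Require Import structures.
From mathcomp Require Import all_boot all_order all_algebra.
From mathcomp Require Import complex.
From mathcomp Require Import boolp reals.
From mathcomp Require Import ring zify.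
Set Implicit Arguments. Unset Strict Implicit. Unset Printing Implicit Defensive.
Import Order.TTheory GRing.Theory Num.Theory.
Local Open Scope ring_scope.
Local Open Scope complex_scope.
Local Open Scope quotient_scope.

(** * The quotient algebra *)

Lemma tree_eqbP : Equality.axiom tree_eqb.
Proof.
elim=> [a|a IHa b IHb] [c|c d] /=; try by constructor.
  by case: a; case: c; constructor.
apply: (iffP andP) => [[/IHa -> /IHb ->]//|[<- <-]].
by split; [apply/IHa|apply/IHb].
Qed.
HB.instance Definition _ := hasDecEq.Build tree tree_eqbP.
HB.instance Definition _ := gen_choiceMixin tree.

(** * Linear extension of maps from bracket monomials to formal combinations *)

Section LinearCombinations.
Variables (K : fieldType) (W : lmodType K) (F : tree -> W).
Implicit Types u v : fa K.

Definition lcomb u : W := \sum_(p <- u) p.1 *: F p.2.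

Lemma lcombD u v : lcomb (fadd u v) = lcomb u + lcomb v.
Proof. by rewrite /lcomb big_cat. Qed.

Lemma lcombZ c u : lcomb (fscale c u) = c *: lcomb u.
Proof.
by rewrite /lcomb /fscale big_map scaler_sumr; apply: eq_bigr => p _; rewrite scalerA.
Qed.

Lemma lcombB u v : lcomb (fsub u v) = lcomb u - lcomb v.
Proof. by rewrite lcombD lcombZ scaleN1r. Qed.

Lemma lcomb_tm s : lcomb (tm K s) = F s.
Proof. by rewrite /lcomb big_seq1 scale1r. Qed.

Lemma lcomb_nil : lcomb [::] = 0.
Proof. exact: big_nil. Qed.

Lemma lcomb_cons p u : lcomb (p :: u) = p.1 *: F p.2 + lcomb u.
Proof. exact: big_cons. Qed.

(** Grouping the terms by monomial rewrites [lcomb] through [coef] alone. The list [S] may be larger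
    than the support, so that two combinations can be compared over a common list. *)
Lemma lcomb_coefE (S : seq tree) u : uniq S -> {subset map snd u <= S} ->
  lcomb u = \sum_(s <- S) coef u s *: F s.
Proof.
move=> uS sub; rewrite /coef.
under [RHS]eq_bigr => s _ do rewrite scaler_suml.
rewrite (exchange_big_dep predT)//= /lcomb big_seq [RHS]big_seq; apply: eq_bigr => p pu.
rewrite -big_filter (eq_filter (a2 := pred1 p.2)) => [|s /=]; last first.
  by rewrite eq_sym.
by rewrite filter_pred1_uniq ?big_seq1 ?sub ?map_f.
Qed.

Lemma eq_lcomb u v : (forall s, coef u s = coef v s) -> lcomb u = lcomb v.
Proof.
move=> uv; pose S := undup (map snd (u ++ v)).
rewrite (@lcomb_coefE S) ?undup_uniq// => [|s su]; last first.
  by rewrite mem_undup map_cat mem_cat su.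
rewrite [RHS](@lcomb_coefE S) ?undup_uniq// => [|s sv]; last first.
  by rewrite mem_undup map_cat mem_cat sv orbT.
by apply: eq_bigr => s _; rewrite uv.
Qed.

End LinearCombinations.

Lemma fbr_tml (K : fieldType) s (u : fa K) :
  fbr (tm K s) u = [seq (p.1, Br s p.2) | p <- u].
Proof.
by rewrite /fbr /= cats0; apply: eq_map => p; rewrite mul1r.
Qed.

Lemma fbr_tmr (K : fieldType) s (u : fa K) :
  fbr u (tm K s) = [seq (p.1, Br p.2 s) | p <- u].
Proof.
by rewrite /fbr /=; elim: u => //= p u ->; rewrite mulr1.
Qed.

Lemma lcomb_brl (K : fieldType) (W : lmodType K) (F : tree -> W) s (u : fa K) :
  lcomb F (fbr (tm K s) u) = lcomb (fun r => F (Br s r)) u.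
Proof. by rewrite fbr_tml /lcomb big_map. Qed.

Lemma lcomb_brr (K : fieldType) (W : lmodType K) (F : tree -> W) s (u : fa K) :
  lcomb F (fbr u (tm K s)) = lcomb (fun r => F (Br r s)) u.
Proof. by rewrite fbr_tmr /lcomb big_map. Qed.

(** * The quotient as a vector space *)

Section Quotient.
Variables (K : fieldType) (lam t : K).
Notation InI := (InI lam t).
Implicit Types u v w : fa K.

Lemma coef_fadd u v s : coef (fadd u v) s = coef u s + coef v s.
Proof. by rewrite /coef /fadd big_cat. Qed.

Lemma coef_fscale c u s : coef (fscale c u) s = c * coef u s.
Proof. by rewrite /coef /fscale big_map mulr_sumr. Qed.

Lemma coef_fsub u v s : coef (fsub u v) s = coef u s - coef v s.
Proof. by rewrite coef_fadd coef_fscale mulN1r. Qed.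

Lemma coef_fnil s : coef [::] s = 0 :> K.
Proof. exact: big_nil. Qed.

Definition fcoefE := (coef_fsub, coef_fadd, coef_fscale, coef_fnil).

Lemma InI_nil : InI [::].
Proof.
apply: (I_ext (I_scale 0 (I_antisym lam t tX tX))) => s.
by rewrite !fcoefE mul0r.
Qed.

(** Membership in the ideal is a mere proposition; classical logic turns it into the boolean
    relation that the quotient construction takes. *)
Definition eqvI : rel (fa K) := fun u v => `[< InI (fsub u v) >].

Lemma eqvI_equiv : equiv_class_of eqvI.
Proof.
split=> [u|u v|v u w].
- by apply/asboolP; apply: (I_ext InI_nil) => s; rewrite !fcoefE subrr.
- by apply/asboolP/asboolP => uv; apply: (I_ext (I_scale (-1) uv)) => s;
    rewrite !fcoefE; ring.
- move=> /asboolP uv /asboolP vw; apply/asboolP.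
  by apply: (I_ext (I_add uv vw)) => s; rewrite !fcoefE; ring.
Qed.

Canonical eqvI_equivRel := EquivRelPack eqvI_equiv.

Definition L := {eq_quot eqvI}.
HB.instance Definition _ := Choice.on L.
HB.instance Definition _ : EqQuotient (fa K) eqvI L := EqQuotient.on L.

Definition cls u : L := \pi_L u.

Lemma clsP u v : reflect (InI (fsub u v)) (cls u == cls v).
Proof. by rewrite /cls eqmodE; apply: asboolP. Qed.

Lemma clsE u v : InI (fsub u v) -> cls u = cls v.
Proof. by move=> /clsP/eqP. Qed.

Lemma cls_ext u v : (forall s, coef u s = coef v s) -> cls u = cls v.
Proof.
move=> uv; apply: clsE; apply: (I_ext InI_nil) => s.
by rewrite !fcoefE uv subrr.
Qed.

Lemma repr_cls u : InI (fsub (repr (cls u)) u).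
Proof. by apply/clsP/eqP; rewrite /cls reprK. Qed.

Lemma cls_repr (e : L) : cls (repr e) = e.
Proof. exact: reprK. Qed.

Definition Ladd (a b : L) : L := cls (fadd (repr a) (repr b)).
Definition Lscale (c : K) (a : L) : L := cls (fscale c (repr a)).

Lemma Ladd_cls u v : Ladd (cls u) (cls v) = cls (fadd u v).
Proof.
apply: clsE; apply: (I_ext (I_add (repr_cls u) (repr_cls v))) => s.
by rewrite !fcoefE; ring.
Qed.

Lemma Lscale_cls c u : Lscale c (cls u) = cls (fscale c u).
Proof.
apply: clsE; apply: (I_ext (I_scale c (repr_cls u))) => s.
by rewrite !fcoefE; ring.
Qed.

Lemma LaddA : associative Ladd.
Proof.
move=> a b c; rewrite -(cls_repr a) -(cls_repr b) -(cls_repr c) !Ladd_cls.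
by apply: cls_ext => s; rewrite !fcoefE; ring.
Qed.

Lemma LaddC : commutative Ladd.
Proof.
move=> a b; rewrite -(cls_repr a) -(cls_repr b) !Ladd_cls.
by apply: cls_ext => s; rewrite !fcoefE; ring.
Qed.

Lemma Ladd0 : left_id (cls [::]) Ladd.
Proof. by move=> a; rewrite -(cls_repr a) Ladd_cls. Qed.

Lemma LaddN : left_inverse (cls [::]) (Lscale (-1)) Ladd.
Proof.
move=> a; rewrite -(cls_repr a) Lscale_cls Ladd_cls.
by apply: cls_ext => s; rewrite !fcoefE; ring.
Qed.

HB.instance Definition _ := GRing.isZmodule.Build L LaddA LaddC Ladd0 LaddN.

Lemma LscaleA c d (a : L) : Lscale c (Lscale d a) = Lscale (c * d) a.
Proof.
rewrite -(cls_repr a) !Lscale_cls; apply: cls_ext => s; rewrite !fcoefE; ring.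
Qed.

Lemma Lscale1 : left_id 1 Lscale.
Proof.
move=> a; rewrite -(cls_repr a) !Lscale_cls; apply: cls_ext => s.
by rewrite !fcoefE; ring.
Qed.

Lemma LscaleDr : right_distributive Lscale +%R.
Proof.
move=> c a b; change (Lscale c (Ladd a b) = Ladd (Lscale c a) (Lscale c b)).
rewrite -(cls_repr a) -(cls_repr b) Ladd_cls !Lscale_cls Ladd_cls.
by apply: cls_ext => s; rewrite !fcoefE; ring.
Qed.

Lemma LscaleDl (a : L) : {morph Lscale^~ a : c d / c + d >-> c + d}.
Proof.
move=> c d; change (Lscale (c + d) a = Ladd (Lscale c a) (Lscale d a)).
rewrite -(cls_repr a) !Lscale_cls Ladd_cls.
by apply: cls_ext => s; rewrite !fcoefE; ring.
Qed.

HB.instance Definition _ :=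
  GRing.Zmodule_isLmodule.Build K L LscaleA Lscale1 LscaleDr LscaleDl.

Lemma clsD u v : cls (fadd u v) = cls u + cls v.
Proof. by rewrite -Ladd_cls. Qed.

Lemma clsZ c u : cls (fscale c u) = c *: cls u.
Proof. by rewrite -Lscale_cls. Qed.

Lemma cls_eq0 u : cls u = 0 <-> InI u.
Proof.
split=> [/eqP/clsP ui|ui]; last first.
  by apply: clsE; apply: (I_ext ui) => s; rewrite !fcoefE; ring.
by apply: (I_ext ui) => s; rewrite !fcoefE; ring.
Qed.

(** * Adjoint operators on the quotient *)

Definition el s : L := cls (tm K s).

Lemma cls_lcomb u : cls u = lcomb el u.
Proof.
elim: u => [|[c s] u IHu]; first by rewrite lcomb_nil.
rewrite lcomb_cons -IHu /el -clsZ -clsD; apply: cls_ext => r.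
by rewrite coef_fadd coef_fscale /coef !big_cons !big_nil /=; case: ifP => _; ring.
Qed.

Lemma lcomb_el0 u : lcomb el u = 0 <-> InI u.
Proof. by rewrite -cls_lcomb; exact: cls_eq0. Qed.

(** Only monomials act: a monomial has a parity, so the sign in the Jacobi identity makes sense
    without a grading on [L]. *)
Definition ad s (e : L) : L := cls (fbr (tm K s) (repr e)).

Lemma ad_cls s u : ad s (cls u) = cls (fbr (tm K s) u).
Proof.
apply: clsE; apply: (I_ext (I_left s (repr_cls u))) => r.
rewrite !fbr_tml /fsub /fadd /fscale map_cat -!map_comp; congr coef.
Qed.

Lemma ad_lcomb s u : ad s (cls u) = lcomb (fun r => el (Br s r)) u.
Proof. by rewrite ad_cls cls_lcomb lcomb_brl. Qed.

Lemma ad_el s r : ad s (el r) = el (Br s r).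
Proof. by rewrite /el ad_lcomb lcomb_tm. Qed.

Lemma ad_linear s : linear (ad s).
Proof.
move=> c a b; rewrite -(cls_repr a) -(cls_repr b) -clsZ -clsD !ad_lcomb.
by rewrite lcombD lcombZ.
Qed.

HB.instance Definition _ s := GRing.isLinear.Build K L L *:%R (ad s) (@ad_linear s).

Lemma adP s c (a b : L) : ad s (c *: a + b) = c *: ad s a + ad s b.
Proof. exact: linearP. Qed.

Lemma ad0 s : ad s 0 = 0.
Proof. exact: linear0. Qed.

Lemma adD s (a b : L) : ad s (a + b) = ad s a + ad s b.
Proof. exact: linearD. Qed.

Lemma adN s (a : L) : ad s (- a) = - ad s a.
Proof. exact: linearN. Qed.

Lemma adZ s c (a : L) : ad s (c *: a) = c *: ad s a.
Proof. exact: linearZ. Qed.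

Lemma L_ind (P : L -> Prop) : P 0 -> (forall c s e, P e -> P (c *: el s + e)) ->
  forall e, P e.
Proof.
move=> P0 PD e; rewrite -(cls_repr e) cls_lcomb.
by elim: (repr e) => [|p u IHu]; rewrite ?lcomb_nil ?lcomb_cons //; apply: PD.
Qed.

Lemma el_antisym a b : el (Br a b) = - (sgn K a b *: el (Br b a)).
Proof.
apply/eqP; rewrite -addr_eq0; apply/eqP.
have /lcomb_el0 := I_antisym lam t a b.
by rewrite /antisym lcombD lcombZ !lcomb_brl !lcomb_tm.
Qed.

(** The Jacobi axiom gives this on monomials and both sides are linear in [e]. Brackets can now be
    computed as supercommutators of operators on [L]. *)
Lemma ad_br a b e : ad (Br a b) e = ad a (ad b e) - sgn K a b *: ad b (ad a e).
Proof.
elim/L_ind: e => [|c s e IHe]; first by rewrite !ad0 scaler0 subr0.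
rewrite !adP IHe !ad_el.
have /lcomb_el0 := I_jacobi lam t a b s.
rewrite /jacobi !lcombB lcombZ lcomb_brr !lcomb_brl !lcomb_tm => /eqP.
rewrite subr_eq0 => /eqP e1.
have -> : el (Br (Br a b) s) = el (Br a (Br b s)) - sgn K a b *: el (Br b (Br a s)).
  by rewrite -e1 subKr.
rewrite scalerBr !scalerDr !opprD !addrA; congr (_ - _).
by rewrite addrAC scalerA mulrC -scalerA.
Qed.

(** The ideal is closed under bracketing on the right with a monomial, so [u] acts by zero on each
    [el s]. Every relator thereby becomes an operator identity. *)
Lemma ad_InI u e : InI u -> lcomb (fun r => ad r e) u = 0.
Proof.
move=> ui; elim/L_ind: e => [|c s e IHe].
  by rewrite /lcomb big1 // => p _; rewrite ad0 scaler0.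
transitivity (c *: lcomb (fun r => ad r (el s)) u + lcomb (fun r => ad r e) u).
  rewrite /lcomb scaler_sumr -big_split /=; apply: eq_bigr => p _.
  by rewrite adP scalerDr !scalerA mulrC.
have e0 : lcomb (fun r => ad r (el s)) u = 0.
  have /lcomb_el0 := I_right s ui; rewrite lcomb_brr => <-.
  by apply: eq_bigr => p _; rewrite ad_el.
by rewrite IHe e0 scaler0 addr0.
Qed.

End Quotient.

(** * Linear identities in modules *)

Section ModuleExpressions.
Variables (K : pzRingType) (W : lmodType K).

(** Reified linear expressions: an identity between vectors is reduced to one scalar identity per
    atom, within reach of [ring] and [field]. *)
Inductive mexpr :=
  | MAtom of nat | MZero | MAdd of mexpr & mexpr | MOpp of mexpr | MScale of K & mexpr.

Fixpoint meval (env : seq W) (e : mexpr) : W :=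
  match e with
  | MAtom i => nth 0 env i
  | MZero => 0
  | MAdd a b => meval env a + meval env b
  | MOpp a => - meval env a
  | MScale c a => c *: meval env a
  end.

Fixpoint mcoef (e : mexpr) (i : nat) : K :=
  match e with
  | MAtom j => if Nat.eqb i j then 1 else 0
  | MZero => 0
  | MAdd a b => mcoef a i + mcoef b i
  | MOpp a => - mcoef a i
  | MScale c a => c * mcoef a i
  end.

Fixpoint mcoef_eq (a b : mexpr) (n : nat) : Prop :=
  match n with
  | 0 => True
  | n'.+1 => mcoef a n' = mcoef b n' /\ mcoef_eq a b n'
  end.

Lemma meval_coef env e : meval env e = \sum_(i < size env) mcoef e i *: nth 0 env i.
Proof.
elim: e => [j||a IHa b IHb|a IHa|c a IHa] /=.
- have eqE i : (if Nat.eqb i j then 1 else 0 : K) *: env`_i = if i == j then env`_i else 0.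
    have -> : Nat.eqb i j = (i == j) by elim: i j => [|i IHi] [|j] //=; rewrite IHi eqSS.
    by case: ifP; rewrite ?scale1r ?scale0r.
  under eq_bigr do rewrite eqE; rewrite -big_mkcond.
  case: (ltnP j (size env)) => jn.
    by rewrite (big_pred1 (Ordinal jn)) // => i; rewrite -val_eqE.
  rewrite nth_default // big1 // => i /eqP ij.
  by have := ltn_ord i; rewrite ij ltnNge jn.
- by rewrite big1 // => i _; rewrite scale0r.
- by rewrite IHa IHb -big_split; apply: eq_bigr => i _; rewrite scalerDl.
- by rewrite IHa -sumrN; apply: eq_bigr => i _; rewrite scaleNr.
- by rewrite IHa scaler_sumr; apply: eq_bigr => i _; rewrite scalerA.
Qed.

Lemma meval_eq env a b : mcoef_eq a b (size env) -> meval env a = meval env b.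
Proof.
move=> ab; rewrite !meval_coef; apply: eq_bigr => i _; congr (_ *: _).
move: {i}(i : nat) (ltn_ord i) => i; elim: (size env) ab => //= n IHn [abn ab].
by rewrite ltnS leq_eqVlt => /predU1P[->//|]; exact: IHn.
Qed.

Lemma lin_use (c : K) (a b l r : W) : l = r -> a + c *: r = b + c *: l -> a = b.
Proof. by move=> -> /addIr. Qed.

End ModuleExpressions.

Ltac m_index a env :=
  match env with
  | a :: _ => constr:(0%N)
  | _ :: ?env' => let n := m_index a env' in constr:(S n)
  end.

Ltac m_add a env :=
  match env with
  | context [a :: _] => env
  | _ => constr:(a :: env)
  end.

Ltac m_atoms e env :=
  lazymatch e with
  | @GRing.zero _ => env
  | @GRing.add _ ?a ?b => let env' := m_atoms a env in m_atoms b env'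
  | @GRing.opp _ ?a => m_atoms a env
  | @GRing.scale _ _ _ ?a => m_atoms a env
  | _ => m_add e env
  end.

Ltac m_reify K e env :=
  lazymatch e with
  | @GRing.zero _ => constr:(@MZero K)
  | @GRing.add _ ?a ?b =>
      let a' := m_reify K a env in let b' := m_reify K b env in constr:(@MAdd K a' b')
  | @GRing.opp _ ?a => let a' := m_reify K a env in constr:(@MOpp K a')
  | @GRing.scale _ _ ?c ?a => let a' := m_reify K a env in constr:(@MScale K c a')
  | _ => let n := m_index e env in constr:(@MAtom K n)
  end.

Ltac module_eq_with K :=
  lazymatch goal with
  | |- @eq ?W ?l ?r =>
    let env0 := constr:(@nil W) in
    let env1 := m_atoms l env0 in
    let env := m_atoms r env1 in
    let l' := m_reify K l env in
    let r' := m_reify K r env in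
    refine (@meval_eq K _ env l' r' _);
    cbn [mcoef_eq mcoef size Nat.eqb]; repeat split
  end.

(* Reduces a = b to (a - b) - c (l - r) = 0 for H : l = r. *)
Ltac use c H := refine (@lin_use _ _ c _ _ _ _ H _).

Ltac module_eq :=
  lazymatch goal with
  | K : numFieldType |- _ => module_eq_with (GRing.PzRing.clone K _)
  | K : fieldType |- _ => module_eq_with (GRing.PzRing.clone K _)
  end.

(** * Operator relations *)

Section Relations.
Variables (K : numFieldType) (lam t : K).
Local Notation L := (L lam t).
Local Notation x := (@ad _ lam t tX).
Local Notation y := (@ad _ lam t tY).
Local Notation y1 := (@ad _ lam t (Yi 1)).
Local Notation h := (@ad _ lam t (Yi 2)).
Local Notation z i := (@ad _ lam t (Zi i)).
Local Notation el := (@el _ lam t).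
Implicit Types e : L.

Definition adE := (adD, adN, adZ, ad0).

Lemma par_Zi i : par (Zi i) = ~~ odd i.
Proof. by elim: i => //= i ->. Qed.

(** [Z] is odd and each bracket with [X] flips the parity, whence the alternating sign. *)
Lemma xz i e : x (z i e) = z i.+1 e - (-1) ^+ i *: z i (x e).
Proof.
have := ad_br tX (Zi i) e; rewrite -[Br tX _]/(Zi i.+1) /sgn par_Zi /= => e1.
rewrite -signr_odd; move: e1; case: (odd i) => /= e1.
  by use (-1 : K) e1; module_eq; ring.
by use (-1 : K) e1; module_eq; ring.
Qed.

Lemma relator_ad i e : (i < 10)%N ->
  lcomb (fun r => ad r e : L) (nth [::] (relators lam t) i) = 0.
Proof. by move=> i10; apply: ad_InI; apply: I_rel. Qed.

Lemma relator_el i : (i < 10)%N -> lcomb el (nth [::] (relators lam t) i) = 0.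
Proof. by move=> i10; apply/lcomb_el0; apply: I_rel. Qed.

Lemma y1E e : y1 e = x (y e) - y (x e).
Proof.
by rewrite [LHS](ad_br tX tY e) /sgn /= scale1r.
Qed.

Lemma xy1 e : x (y1 e) = h e - y1 (x e).
Proof.
have := ad_br tX (Yi 1) e; rewrite /sgn /= -[Br tX (Yi 1)]/(Yi 2) => e1.
by use (-1 : K) e1; module_eq; ring.
Qed.

Lemma y_y1 e : y (y1 e) = y1 (y e).
Proof.
have := relator_ad e (isT : 0 < 10)%N; cbn [nth relators]; rewrite lcomb_tm ad_br /sgn /= => e1.
by use (1 : K) e1; module_eq; ring.
Qed.

Lemma h_y e : h (y e) = y (h e) + 2 *: y e.
Proof.
have := relator_ad e (isT : 1 < 10)%N.
cbn [nth relators]; rewrite lcombB lcombZ !lcomb_tm ad_br /sgn /= => e1.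
by use (1 : K) e1; module_eq; ring.
Qed.

Lemma h_x e : h (x e) = x (h e) - x e.
Proof.
have := relator_ad e (isT : 2 < 10)%N.
cbn [nth relators]; rewrite lcombD !lcomb_tm ad_br /sgn /= => e1.
by use (1 : K) e1; module_eq; ring.
Qed.

Lemma y1_z0 e : y1 (z 0 e) = - z 0 (y1 e).
Proof.
have := relator_ad e (isT : 4 < 10)%N; cbn [nth relators]; rewrite lcomb_tm ad_br /sgn /=.
rewrite -[Br tX tY]/(Yi 1) -[tZ]/(Zi 0) => e1.
by use (1 : K) e1; module_eq; ring.
Qed.

Lemma z7 e : z 7 e = 0.
Proof. by have := relator_ad e (isT : 5 < 10)%N; cbn [nth relators]; rewrite lcomb_tm. Qed.

Lemma h_z0 e : h (z 0 e) = z 0 (h e) + 3 *: z 0 e.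
Proof.
have := relator_ad e (isT : 6 < 10)%N.
cbn [nth relators]; rewrite lcombB lcombZ !lcomb_tm ad_br /sgn /= -[tZ]/(Zi 0) => e1.
by use (1 : K) e1; module_eq; ring.
Qed.

Lemma r21 e : 3 *: (z 0 (z 3 e) - z 3 (z 0 e)) + 2 *: (z 1 (z 2 e) - z 2 (z 1 e)) =
  (6 * t * (2 * lam + 1)) *: z 0 e.
Proof.
have := relator_ad e (isT : 7 < 10)%N.
cbn [nth relators]; rewrite lcombB lcombD !lcombZ !lcomb_tm !ad_br /sgn /= -[tZ]/(Zi 0) => e1.
by use (1 : K) e1; module_eq; ring.
Qed.

Lemma r22 e : z 1 (z 3 e) - z 3 (z 1 e) =
  (2 * t ^+ 2 * (lam - 1) * (lam + 2)) *: y e + (2 * t * (2 * lam + 1)) *: z 1 e.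
Proof.
have := relator_ad e (isT : 8 < 10)%N.
cbn [nth relators]; rewrite !lcombB !lcombZ !lcomb_tm !ad_br /sgn /= => e1.
by use (1 : K) e1; module_eq; ring.
Qed.

Lemma r31 e : z 1 (z 0 (z 0 e)) = z 0 (z 0 (z 1 e)).
Proof.
have := relator_ad e (isT : 9 < 10)%N.
cbn [nth relators]; rewrite lcomb_tm ad_br !(ad_br tZ tZ) /sgn /= -[tZ]/(Zi 0) !adE => e1.
by use (2^-1 : K) e1; module_eq; field.
Qed.

(* Bracketing (0.1) with X expresses [Y_1, Y_1] through [Y_2, Y]. *)
Lemma y1y1 e : y1 (y1 e) = y e.
Proof.
have e1 := congr1 x (y_y1 e); have e2 := y_y1 (x e).
have e3 := h_y e.
have xy a : x (y a) = y1 a + y (x a) by rewrite y1E addrNK.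
rewrite !xy !xy1 !xy !adE in e1.
by use (2^-1 : K) e1; use (2^-1 : K) e2; use (2^-1 : K) e3; module_eq; field.
Qed.

Lemma h_z i e : h (z i e) = z i (h e) + (3 - i%:R) *: z i e.
Proof.
elim: i e => [|i IHi] e; first by rewrite h_z0 subr0.
have zS a : z i.+1 a = x (z i a) + (-1) ^+ i *: z i (x a) by rewrite xz addrNK.
rewrite !zS !adE !h_x !IHi !h_x !adE -natr1.
by module_eq; ring.
Qed.

(* The coefficient in [Y_1 X^n v = d_n X^(n-1) v] for a lowest weight vector v
   with [Y_2 v = k v]. *)
Definition dcoef (k : K) (n : nat) : K :=
  if odd n then k - n./2%:R else - n./2%:R.

Lemma dcoefS k n : dcoef k n.+1 = k - n%:R - dcoef k n.
Proof.
rewrite /dcoef /= uphalf_half.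
have -> : n%:R = (odd n)%:R + n./2%:R + n./2%:R :> K.
  by rewrite -!natrD -addnA addnn odd_double_half.
case: (odd n) => /=; ring.
Qed.

(** [Z] is itself a lowest weight vector with [Y_2]-eigenvalue 3, so [dcoef 3] governs its string.
    At [i = 0] the coefficient vanishes, which makes the default value of [i.-1] harmless. *)
Lemma y1_z i e : y1 (z i e) = dcoef 3 i *: z i.-1 e - (-1) ^+ i *: z i (y1 e).
Proof.
elim: i e => [|i IHi] e.
  by rewrite y1_z0 /dcoef /=; module_eq; ring.
have zS a : z i.+1 a = x (z i a) + (-1) ^+ i *: z i (x a) by rewrite xz addrNK.
have y1x a : y1 (x a) = h a - x (y1 a) by rewrite xy1 subKr.
rewrite !zS /= !adE y1x !IHi !adE h_z y1x dcoefS !adE exprS.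
case: i {IHi zS} => [|i].
  by rewrite /dcoef /=; module_eq; ring.
rewrite /= (xz i) exprS -(signr_odd _ i); case: (odd i) => /=; module_eq; ring.
Qed.

Lemma z_ge7 i e : (7 <= i)%N -> z i e = 0.
Proof.
elim: i e => // i IHi e; rewrite leq_eqVlt => /predU1P[<-|]; first exact: z7.
rewrite ltnS => i7.
have -> : z i.+1 e = x (z i e) + (-1) ^+ i *: z i (x e) by rewrite xz addrNK.
by rewrite !IHi // ad0 scaler0 addr0.
Qed.

(** This and the next relations are successive supercommutators with [X]: apply [x] to the previous
    relation, then subtract that relation at [x e] if it is even, or add it if it is odd. *)
Lemma r22_1 e : z 2 (z 3 e) - z 3 (z 2 e) + (z 1 (z 4 e) - z 4 (z 1 e)) =
  (2 * t ^+ 2 * (lam - 1) * (lam + 2)) *: y1 e + (2 * t * (2 * lam + 1)) *: z 2 e.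
Proof.
have e1 := congr1 x (r22 e); have e2 := r22 (x e).
rewrite !(adE, xz) in e1; rewrite y1E.
use (1 : K) e1; use (-1 : K) e2; module_eq; ring.
Qed.

Lemma r22_2 e : z 1 (z 5 e) - z 5 (z 1 e) =
  (2 * t ^+ 2 * (lam - 1) * (lam + 2)) *: h e + (2 * t * (2 * lam + 1)) *: z 3 e.
Proof.
have e1 := congr1 x (r22_1 e); have e2 := r22_1 (x e).
rewrite !(adE, xz, xy1) in e1.
use (1 : K) e1; use (1 : K) e2; module_eq; ring.
Qed.

Lemma r22_3 e : z 2 (z 5 e) - z 5 (z 2 e) + (z 1 (z 6 e) - z 6 (z 1 e)) =
  (2 * t ^+ 2 * (lam - 1) * (lam + 2)) *: x e + (2 * t * (2 * lam + 1)) *: z 4 e.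
Proof.
have e1 := congr1 x (r22_2 e); have e2 := r22_2 (x e).
rewrite h_x in e2; rewrite !(adE, xz) in e1.
use (1 : K) e1; use (-1 : K) e2; module_eq; ring.
Qed.

(** The brackets of [Z_2] with [Z_6] cancel and those with [Z_7] vanish, leaving a single
    commutator. The factor 4 instead of 2 reflects [[X, X] = 2 X^2]. *)
Lemma r22_4 e : z 3 (z 5 e) - z 5 (z 3 e) =
  (4 * t ^+ 2 * (lam - 1) * (lam + 2)) *: x (x e) + (2 * t * (2 * lam + 1)) *: z 5 e.
Proof.
have e1 := congr1 x (r22_3 e); have e2 := r22_3 (x e).
rewrite !(adE, xz, z7) in e1.
use (1 : K) e1; use (1 : K) e2; module_eq; ring.
Qed.

Lemma r21_1 e : 5 *: (z 1 (z 3 e) - z 3 (z 1 e)) - 3 *: (z 0 (z 4 e) + z 4 (z 0 e)) +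
  4 *: z 2 (z 2 e) = (6 * t * (2 * lam + 1)) *: z 1 e.
Proof.
have e1 := congr1 x (r21 e); have e2 := r21 (x e).
rewrite !(adE, xz) in e1.
use (1 : K) e1; use (1 : K) e2; module_eq; ring.
Qed.

Lemma r21_2 e : (z 2 (z 3 e) - z 3 (z 2 e)) + 2 *: (z 1 (z 4 e) - z 4 (z 1 e)) +
  3 *: (z 0 (z 5 e) - z 5 (z 0 e)) = (6 * t * (2 * lam + 1)) *: z 2 e.
Proof.
have e1 := congr1 x (r21_1 e); have e2 := r21_1 (x e).
rewrite !(adE, xz) in e1.
use (1 : K) e1; use (-1 : K) e2; module_eq; ring.
Qed.

End Relations.

(** * Strings over the lowest weight vectors *)

(** For [m] even both [Z] and [Z_1] turn out to annihilate [v_m], so [Z_2] is the first bracket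
    leading to a new vector; for [m] odd it is [Z]. *)
Fixpoint vtree (m : nat) : tree :=
  match m with
  | 0 => tY
  | n.+1 => if odd n then Br tZ (vtree n) else Br (Zi 2) (vtree n)
  end.

(* [vtree m] has weight [- depth m]. *)
Definition depth (m : nat) : nat := m.*2 + 2 - odd m.

Section Filtration.
Variables (K : numFieldType) (lam t : K).
Local Notation L := (L lam t).
Local Notation x := (@ad _ lam t tX).
Local Notation y := (@ad _ lam t tY).
Local Notation y1 := (@ad _ lam t (Yi 1)).
Local Notation h := (@ad _ lam t (Yi 2)).
Local Notation z i := (@ad _ lam t (Zi i)).
Local Notation el := (@el _ lam t).
Local Notation v m := (el (vtree m)).
Local Notation xn n := (iter n (@ad _ lam t tX)).
Implicit Types (e : L) (d : int).

(* [gspan m d] is the part of weight -d of the span of the strings over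
   v_0, ..., v_m. *)
Inductive gspan (m : nat) : int -> L -> Prop :=
  | gspan0 d : gspan m d 0
  | gspanZ d c e : gspan m d e -> gspan m d (c *: e)
  | gspanD d e f : gspan m d e -> gspan m d f -> gspan m d (e + f)
  | gspang d j n : (j <= m)%N -> d = (depth j)%:Z - n%:Z -> gspan m d (xn n (v j)).

Lemma gspanN m d e : gspan m d e -> gspan m d (- e).
Proof. by rewrite -scaleN1r; apply: gspanZ. Qed.

Lemma gspanB m d e f : gspan m d e -> gspan m d f -> gspan m d (e - f).
Proof. by move=> We /gspanN; apply: gspanD. Qed.

Lemma gspan_sub m d e f : gspan m d (e - f) -> gspan m d f -> gspan m d e.
Proof. by move=> /gspanD Wef /Wef; rewrite addrNK. Qed.

Lemma gspan_scale m d c e : c != 0 -> gspan m d (c *: e) -> gspan m d e.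
Proof. by move=> c0 /(gspanZ c^-1); rewrite scalerA mulVf // scale1r. Qed.

Lemma gspan_le m n d e : (m <= n)%N -> gspan m d e -> gspan n d e.
Proof.
move=> mn; elim=> {d e}; [exact: gspan0|by move=> *; apply: gspanZ|by move=> *; apply: gspanD|].
by move=> d j k jm; apply: gspang; apply: leq_trans mn.
Qed.

Lemma gspan_x m d e : gspan m d e -> gspan m (d - 1) (x e).
Proof.
elim=> {d e} [d|d c e _ We|d e f _ We _ Wf|d j n jm ->].
- by rewrite ad0; apply: gspan0.
- by rewrite adZ; apply: gspanZ.
- by rewrite adD; apply: gspanD.
- by rewrite -iterS; apply: gspang => //; lia.
Qed.

Lemma ltn_depth j m : (j < m)%N -> (depth j < depth m)%N.
Proof. by rewrite /depth; case: (odd j) (odd m) => -[] /=; lia. Qed.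

(** Strings over earlier vectors start at a smaller depth and [ad X] only decreases [d], so [v_m]
    alone reaches degree [depth m] and nothing lies above it. *)
Lemma gspan_top m d e : gspan m d e -> (depth m)%:Z <= d ->
  exists2 c, e = c *: v m & (d != (depth m)%:Z -> c = 0).
Proof.
elim=> {d e} [d|d c e _ IHe|d e f _ IHe _ IHf|d j n jm ->] dm.
- by exists 0; rewrite ?scale0r.
- by have [a -> a0] := IHe dm; exists (c * a); rewrite ?scalerA // => /a0->; rewrite mulr0.
- have [a -> a0] := IHe dm; have [b -> b0] := IHf dm.
  by exists (a + b); rewrite ?scalerDl // => dd; rewrite a0 ?b0 ?addr0.
- move: jm; rewrite leq_eqVlt => /predU1P[jE|/ltn_depth]; last by lia.
  have n0 : n = 0%N by move: dm; rewrite jE; lia.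
  by exists 1; rewrite ?scale1r n0 jE //= subr0 eqxx.
Qed.

Lemma gspan_gt m d e : gspan m d e -> (depth m)%:Z < d -> e = 0.
Proof.
move=> /gspan_top We md; have [c -> c0] := We (ltW md).
by rewrite c0 ?scale0r // gt_eqF.
Qed.

Lemma gspan_eq m e : gspan m (depth m)%:Z e -> exists c, e = c *: v m.
Proof. by move=> /gspan_top [//|c ->]; exists c. Qed.

(** The top string meets each degree in at most one vector. Above its depth the absolute value would
    give a wrong exponent, and the second clause makes the coefficient zero there. *)
Lemma gspan_split m d e : gspan m.+1 d e -> exists2 c, gspan m d
  (e - c *: xn `|(depth m.+1)%:Z - d|%N (v m.+1)) & ((depth m.+1)%:Z < d -> c = 0).
Proof.
elim=> {d e} [d|d c e _ [a We a0]|d e f _ [a We a0] _ [b Wf b0]|d j n jm ->].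
- by exists 0; rewrite ?scale0r ?subr0 //; apply: gspan0.
- exists (c * a); last by move=> /a0->; rewrite mulr0.
  by rewrite -scalerA -scalerBr; apply: gspanZ.
- exists (a + b); last by move=> dd; rewrite a0 ?b0 ?addr0.
  by rewrite scalerDl opprD addrACA; apply: gspanD.
- move: jm; rewrite leq_eqVlt => /predU1P[->|jm].
    exists 1; last by lia.
    rewrite scale1r (_ : `|_|%N = n) ?subrr; last by lia.
    exact: gspan0.
  by exists 0; rewrite // scale0r subr0; apply: gspang.
Qed.

(** * Action of osp(1|2) and of the [Z_i] on the strings *)

Definition lowest (m : nat) := y1 (v m) = 0 /\ h (v m) = (depth m)%:R *: v m.

Lemma dcoef0 (k : K) : dcoef k 0 = 0.
Proof. exact: oppr0. Qed.

Lemma h_iter e (k : K) n : h e = k *: e -> h (xn n e) = (k - n%:R) *: xn n e.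
Proof.
move=> he; elim: n => [|n IHn] /=; first by rewrite subr0.
by rewrite h_x IHn adZ -natr1; module_eq; ring.
Qed.

Lemma y1_iter e (k : K) n : y1 e = 0 -> h e = k *: e ->
  y1 (xn n e) = dcoef k n *: xn n.-1 e.
Proof.
move=> e0 he; elim: n => [|n IHn] /=; first by rewrite e0 dcoef0 scale0r.
have -> : y1 (x (xn n e)) = h (xn n e) - x (y1 (xn n e)) by rewrite xy1 subKr.
rewrite IHn (h_iter _ he) adZ dcoefS; case: n {IHn} => [|n] /=.
  by rewrite dcoef0; module_eq; ring.
by module_eq; ring.
Qed.

Lemma h_xn m n : lowest m -> h (xn n (v m)) = ((depth m)%:R - n%:R) *: xn n (v m).
Proof. by case=> _; apply: h_iter. Qed.

Lemma y1_xn m n : lowest m -> y1 (xn n (v m)) = dcoef (depth m)%:R n *: xn n.-1 (v m).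
Proof. by case; apply: y1_iter. Qed.

Lemma gspan_y1 m d e : (forall j, (j <= m)%N -> lowest j) -> gspan m d e -> gspan m (d + 1) (y1 e).
Proof.
move=> low; elim=> {d e} [d|d c e _ We|d e f _ We _ Wf|d j n jm ->].
- by rewrite ad0; apply: gspan0.
- by rewrite adZ; apply: gspanZ.
- by rewrite adD; apply: gspanD.
- rewrite y1_xn; last exact: low.
  case: n => [|n]; first by rewrite dcoef0 scale0r; apply: gspan0.
  by apply: gspanZ; apply: gspang => //; lia.
Qed.

Lemma gspan_h m d e : (forall j, (j <= m)%N -> lowest j) -> gspan m d e -> gspan m d (h e).
Proof.
move=> low; elim=> {d e} [d|d c e _ We|d e f _ We _ Wf|d j n jm ->].
- by rewrite ad0; apply: gspan0.
- by rewrite adZ; apply: gspanZ.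
- by rewrite adD; apply: gspanD.
- by rewrite h_xn; [apply: gspanZ; apply: gspang|exact: low].
Qed.

Lemma gspan_y m d e : (forall j, (j <= m)%N -> lowest j) -> gspan m d e -> gspan m (d + 2) (y e).
Proof.
move=> low /(gspan_y1 low)/(gspan_y1 low); rewrite y1y1; congr gspan; lia.
Qed.

Definition zclosed (m : nat) :=
  forall i, gspan m.+1 ((depth m)%:Z + 3 - i%:Z) (z i (v m)).

(** [Z_i] is moved past the powers of [X] down to the lowest weight vector. Each passage also
    creates a term with [Z_{i+1}], so the induction runs over all [i] at once. *)
Lemma gspan_z m d e i : (forall j, (j <= m)%N -> zclosed j) -> gspan m d e ->
  gspan m.+1 (d + 3 - i%:Z) (z i e).
Proof.
move=> zc; elim=> {d e} [d|d c e _ We|d e f _ We _ Wf|d j n jm ->].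
- by rewrite ad0; apply: gspan0.
- by rewrite adZ; apply: gspanZ.
- by rewrite adD; apply: gspanD.
- elim: n i => [|n IHn] i /=.
    by rewrite subr0; apply: gspan_le (zc j jm i).
  have -> : z i (x (xn n (v j))) =
      (-1) ^+ i *: (z i.+1 (xn n (v j)) - x (z i (xn n (v j)))).
    rewrite xz -(signr_odd _ i); case: (odd i) => /=; module_eq; ring.
  apply/gspanZ/gspanB; first by have := IHn i.+1; congr gspan; lia.
  by have := gspan_x (IHn i); congr gspan; lia.
Qed.

Fixpoint zsign (i n : nat) : K :=
  match n with 0 => 1 | n'.+1 => (-1) ^+ i * zsign i.+1 n' end.

(* Modulo the image of x, [z i] slides past [x] at the cost of a sign. *)
Lemma z_xn M D i n e : (forall j, (j < i + n)%N -> gspan M (D - j%:Z) (z j e)) ->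
  gspan M (D - (i + n)%:Z) (z i (xn n e) - zsign i n *: z (i + n) e).
Proof.
elim: n i => [|n IHn] i We; first by rewrite addn0 scale1r subrr; apply: gspan0.
have Wi : gspan M (D - (i + n)%:Z) (z i (xn n e)).
  apply: gspan_sub; first by apply: IHn => j jn; apply: We; lia.
  by apply/gspanZ/We; lia.
have -> : z i (xn n.+1 e) - zsign i n.+1 *: z (i + n.+1) e =
    (-1) ^+ i *: ((z i.+1 (xn n e) - zsign i.+1 n *: z (i.+1 + n) e) - x (z i (xn n e))).
  rewrite xz addSnnS /= -(signr_odd _ i); case: (odd i) => /=; module_eq; ring.
apply/gspanZ/gspanB; last by have := gspan_x Wi; congr gspan; lia.
by have := IHn i.+1; rewrite !addSnnS; apply.
Qed.

End Filtration.

(** * Closure under Z *)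

Ltac gspan_combine :=
  lazymatch goal with
  | |- @gspan _ _ _ _ _ (_ + _) => apply: gspanD; gspan_combine
  | |- @gspan _ _ _ _ _ (- _) => apply: gspanN; gspan_combine
  | |- @gspan _ _ _ _ _ (_ *: _) => apply: gspanZ; gspan_combine
  | _ => idtac
  end.

Section Straightening.
Variables (K : numFieldType) (lam t : K).
Local Notation L := (L lam t).
Local Notation x := (@ad _ lam t tX).
Local Notation y := (@ad _ lam t tY).
Local Notation y1 := (@ad _ lam t (Yi 1)).
Local Notation h := (@ad _ lam t (Yi 2)).
Local Notation z i := (@ad _ lam t (Zi i)).
Local Notation el := (@el _ lam t).
Local Notation v m := (el (vtree m)).
Local Notation xn n := (iter n (@ad _ lam t tX)).
Local Notation gspan := (@gspan _ lam t).
Local Notation lowest := (@lowest _ lam t).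
Local Notation zclosed := (@zclosed _ lam t).
Implicit Types (e : L) (d : int).

Lemma v_even m : ~~ odd m -> v m.+1 = z 2 (v m).
Proof. by move=> /negbTE om; rewrite ad_el /= om. Qed.

Lemma v_odd m : odd m -> v m.+1 = z 0 (v m).
Proof. by move=> om; rewrite ad_el /= om. Qed.

(** Apply [Y_1]: since it kills [u], it sends [[Z_{i+1}, u]] to a multiple of [[Z_i, u]], and it
    sends [X^(n+1) v_{m+1}] to a multiple of [X^n v_{m+1}]. Comparing the two determines the new
    coefficient from the old one. *)
Lemma coef_next m d i n b b' u :
  (forall j, (j <= m.+1)%N -> lowest j) -> y1 u = 0 ->
  (depth m.+1)%:Z = d + n%:Z -> gspan m.+1 (d - 1) (z i.+1 u) ->
  dcoef 3 i.+1 * b = b' * dcoef (depth m.+1)%:R n.+1 ->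
  dcoef (depth m.+1)%:R n.+1 != 0 :> K ->
  gspan m d (z i u - b *: xn n (v m.+1)) ->
  gspan m (d - 1) (z i.+1 u - b' *: xn n.+1 (v m.+1)).
Proof.
move=> low u0 dE Wu cE dn0 Wb.
have [c Wc _] := gspan_split Wu.
rewrite (_ : `|_|%N = n.+1) in Wc; last by lia.
have low' j : (j <= m)%N -> lowest j by move=> jm; apply: low; apply: leqW.
have Wd : gspan m d ((dcoef 3 i.+1 * b - c * dcoef (depth m.+1)%:R n.+1) *: xn n (v m.+1)).
  have W1 := gspan_y1 low' Wc; rewrite subrK in W1.
  have := gspanB W1 (gspanZ (dcoef 3 i.+1) Wb); congr gspan.
  rewrite adD adN adZ y1_xn; last exact: low.
  by rewrite y1_z u0 ad0 [n.+1.-1]/= [i.+1.-1]/=; module_eq; ring.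
have [bc|bc] := eqVneq c b'; first by rewrite -bc.
have Wn : gspan m (d - 1) (xn n.+1 (v m.+1)).
  apply: gspan_x; apply: gspan_scale Wd.
  by rewrite cE -mulrBl mulf_neq0 // subr_eq0 eq_sym.
have -> : z i.+1 u - b' *: xn n.+1 (v m.+1) =
  z i.+1 u - c *: xn n.+1 (v m.+1) + (c - b') *: xn n.+1 (v m.+1).
  by module_eq; ring.
by apply: gspanD => //; apply: gspanZ.
Qed.

(** Here [s] is the index of the bracket that defines [v_{m+1}]: 2 for [m] even, 0 for [m] odd. All
    products [Z_i Z_j] on [v_m] of a fixed total index reduce to multiples of the one unknown
    [[Z_N, v_{m+1}]], so a quadratic relation becomes a linear equation for it. *)
Lemma zz_mod m s (b : nat -> K) i j N :
  (forall i, (i <= m.+1)%N -> lowest i) -> (forall i, (i <= m)%N -> zclosed i) ->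
  (depth m.+1)%:Z = (depth m)%:Z + 3 - s%:Z ->
  (forall i, gspan m ((depth m)%:Z + 3 - i%:Z) (z i (v m) - b i *: xn (i - s) (v m.+1))) ->
  (forall j, (j < s)%N -> b j = 0) ->
  (forall l, (l < N)%N -> gspan m.+2 ((depth m.+1)%:Z + 3 - l%:Z) (z l (v m.+1))) ->
  (i + j = N + s)%N ->
  gspan m.+2 ((depth m.+1)%:Z + 3 - N%:Z)
    (z i (z j (v m)) - (b j * zsign K i (j - s)) *: z N (v m.+1)).
Proof.
move=> low zc dE Wb bs WN ij.
have zc' k : (k <= m)%N -> zclosed k by move=> km; apply: zc.
have W1 := gspan_le (leqnSn _) (gspan_z i zc' (Wb j)).
(* For [j < s] the truncated difference [j - s] is meaningless, but then [b j = 0]. *)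
have [js|js] := ltnP j s.
  rewrite bs // mul0r scale0r subr0; move: W1; rewrite bs // scale0r subr0.
  by congr gspan; lia.
have W2 : gspan m.+2 ((depth m.+1)%:Z + 3 - (i + (j - s))%N%:Z)
   (z i (xn (j - s) (v m.+1)) - zsign K i (j - s) *: z (i + (j - s)) (v m.+1)).
  by apply: z_xn => l lN; apply: WN; lia.
have Nij : (i + (j - s) = N)%N by lia.
rewrite Nij in W2.
have -> : z i (z j (v m)) - (b j * zsign K i (j - s)) *: z N (v m.+1) =
  z i (z j (v m)) - b j *: z i (xn (j - s) (v m.+1)) + b j *:
   (z i (xn (j - s) (v m.+1)) - zsign K i (j - s) *: z N (v m.+1)).
  by module_eq; ring.
by apply: gspanD; [move: W1; rewrite adD adN adZ; congr gspan; lia|apply: gspanZ].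
Qed.

(** * The step from an even index m to m + 2 *)

Section EvenStep.
Variable m : nat.
Hypothesis m_even : ~~ odd m.
Hypothesis low : forall j, (j <= m)%N -> lowest j.
Hypothesis zc : forall j, (j <= m)%N -> zclosed j.
Hypothesis z0v : z 0 (v m) = 0.
Hypothesis z1v : z 1 (v m) = 0.
Local Notation k := ((depth m)%:R : K).

Lemma depthS_even : depth m.+1 = (depth m).+1.
Proof. by rewrite /depth /= (negbTE m_even); lia. Qed.

Lemma depthSS_even : depth m.+2 = (depth m + 4)%N.
Proof. by rewrite /depth /= negbK (negbTE m_even); lia. Qed.

(** The denominators and leading coefficients below are products of numerals and factors [k + j] and
    [k - 1]; for [m] even the depth is at least 2. *)
Lemma depth_neq0 j : k + j%:R != 0.
Proof. by rewrite -natrD pnatr_eq0 /depth (negbTE m_even); lia. Qed.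

Lemma depth_pred_neq0 : k - 1 != 0.
Proof. by rewrite subr_eq0 (eqr_nat K _ 1) /depth (negbTE m_even); lia. Qed.

(** [Y_1] sends [[Z_2, v_m]] to a multiple of [[Z_1, v_m]], which is zero by [z1v]. *)
Lemma lowest_even : lowest m.+1.
Proof.
have [y1v hv] := low (leqnn m).
rewrite /lowest v_even // y1_z y1v ad0 scaler0 subr0 [2.-1]/= z1v scaler0; split=> //.
rewrite h_z hv adZ depthS_even -natr1; module_eq; ring.
Qed.

Lemma lowest_evenS : lowest m.+2.
Proof.
have [y1v hv] := lowest_even.
have odd_m1 : odd m.+1 by rewrite /= m_even.
rewrite /lowest v_odd // y1_z y1v ad0 scaler0 subr0 dcoef0 scale0r; split=> //.
rewrite h_z hv adZ depthSS_even depthS_even -natr1 natrD; module_eq; ring.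
Qed.

Let low1 j : (j <= m.+1)%N -> lowest j.
Proof. by rewrite leq_eqVlt => /predU1P[->|/low//]; exact: lowest_even. Qed.

Let low2 j : (j <= m.+2)%N -> lowest j.
Proof. by rewrite leq_eqVlt => /predU1P[->|/low1//]; exact: lowest_evenS. Qed.

(* The scalar b_i with [Z_i, v_m] = b_i X^(i-2) v_{m+1} modulo lower strings;
   commutation with ad [X,Y] determines it from b_2 = 1. *)
Definition coef_even (i : nat) : K :=
  match i with
  | 2 => 1
  | 3 => 2 / (k + 1)
  | 4 => 4 / (k + 1)
  | 5 => 4 / (k * (k + 1))
  | 6 => 6 / (k * (k + 1))
  | _ => 0
  end.

Lemma zv_even i :
  gspan m ((depth m)%:Z + 3 - i%:Z) (z i (v m) - coef_even i *: xn (i - 2) (v m.+1)).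
Proof.
have k0 := depth_neq0 0; rewrite addr0 in k0.
have k1 := depth_neq0 1.
have y1v : y1 (v m) = 0 by case: (low (leqnn m)).
have W j : gspan m.+1 ((depth m)%:Z + 3 - j%:Z - 1) (z j.+1 (v m)).
  by have := zc (leqnn m) j.+1; congr gspan; lia.
have dS : (depth m.+1)%:R = k + 1 by rewrite depthS_even natr1.
have next j n : (j = n + 2)%N ->
    dcoef 3 j.+1 * coef_even j = coef_even j.+1 * dcoef (k + 1) n.+1 -> dcoef (k + 1) n.+1 != 0 ->
    gspan m ((depth m)%:Z + 3 - j%:Z) (z j (v m) - coef_even j *: xn n (v m.+1)) ->
    gspan m ((depth m)%:Z + 3 - j.+1%:Z) (z j.+1 (v m) - coef_even j.+1 *: xn n.+1 (v m.+1)).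
  move=> jn cEq dn0 Wj.
  have := @coef_next m _ j n (coef_even j) (coef_even j.+1) (v m) low1 y1v _ (W j) _ _ Wj.
  rewrite dS => Wn; have := Wn _ cEq dn0; rewrite depthS_even jn.
  have -> : ((depth m)%:Z + 3 - (n + 2)%N%:Z - 1 = (depth m)%:Z + 3 - (n + 2).+1%:Z) by lia.
  by apply; lia.
case: i => [|[|i]]; rewrite /coef_even ?scale0r ?subr0.
- by rewrite z0v; apply: gspan0.
- by rewrite z1v; apply: gspan0.
have W2 : gspan m ((depth m)%:Z + 3 - 2%:Z) (z 2 (v m) - coef_even 2 *: xn 0 (v m.+1)).
  by rewrite /= scale1r -v_even // subrr; apply: gspan0.
have W3 : gspan m ((depth m)%:Z + 3 - 3%:Z) (z 3 (v m) - coef_even 3 *: xn 1 (v m.+1)).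
  apply: (next 2 0) W2 => //; rewrite /dcoef /= ?subr0 //.
  by field.
have W4 : gspan m ((depth m)%:Z + 3 - 4%:Z) (z 4 (v m) - coef_even 4 *: xn 2 (v m.+1)).
  apply: (next 3 1) W3 => //; rewrite /dcoef /= ?oppr_eq0 ?oner_eq0 //.
  by field.
have W5 : gspan m ((depth m)%:Z + 3 - 5%:Z) (z 5 (v m) - coef_even 5 *: xn 3 (v m.+1)).
  apply: (next 4 2) W4 => //; rewrite /dcoef /= ?addrK //.
  by field; rewrite k0 k1.
have W6 : gspan m ((depth m)%:Z + 3 - 6%:Z) (z 6 (v m) - coef_even 6 *: xn 4 (v m.+1)).
  apply: (next 5 3) W5 => //; rewrite /dcoef /= ?oppr_eq0 ?pnatr_eq0 //.
  by field; rewrite k0 k1.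
case: i => [|[|[|[|[|i]]]]] //.
by rewrite z_ge7 // scale0r subr0; apply: gspan0.
Qed.

(** For each [N > 0] one relation has quadratic terms of total index [N + 2]: [r21] for [N = 1],
    then [r22] and [r22_1] to [r22_4]. Evaluated at [v_m], it can be solved for [[Z_N, v_{m+1}]].
    For [N = 0] this bracket is [v_{m+2}]. *)
Lemma z_odd_lt N : (N <= 6)%N ->
  (forall l, (l < N)%N -> gspan m.+2 ((depth m.+1)%:Z + 3 - l%:Z) (z l (v m.+1))) ->
  gspan m.+2 ((depth m.+1)%:Z + 3 - N%:Z) (z N (v m.+1)).
Proof.
move=> N6 WN.
have k0 := depth_neq0 0; rewrite addr0 in k0.
have k1 := depth_neq0 1; have k2 := depth_neq0 2; have k3 := depth_neq0 3.
have k4 := depth_neq0 4; have kp := depth_pred_neq0.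
pose d := (depth m.+1)%:Z + 3 - N%:Z.
(* The remainder of a product once its multiple of the unknown has been removed; [zz_mod] places it
   in the span. *)
pose T i j := z i (z j (v m)) - (coef_even j * zsign K i (j - 2)) *: z N (v m.+1).
have WT i j : (i + j = N + 2)%N -> gspan m.+2 d (T i j).
  move=> ij; apply: (@zz_mod m 2 coef_even i j N low1 zc) => //.
  - by rewrite depthS_even; lia.
  - exact: zv_even.
  - by move=> [|[|[]]].
have Wz i : (i = N.-1) -> (0 < N)%N -> gspan m.+2 d (z i (v m)).
  move=> -> N0; have := gspan_le (leqnSn _) (zc (leqnn m) N.-1); congr gspan.
  by rewrite /d depthS_even; lia.
have Wv : gspan m (depth m)%:Z (v m) by apply: (@gspang _ _ _ _ _ m 0); lia.
have dE : d = (depth m)%:Z + 4 - N%:Z by rewrite /d depthS_even; lia.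
have Wop e d' : gspan m d' e -> d' = d -> gspan m.+2 d e.
  by move=> We <-; apply: gspan_le We; rewrite -addn2 leq_addr.
(* For [N] from 2 to 6 the right-hand side of the relation contains, in this order, [Y], [Y_1],
   [Y_2], [X], [X^2] applied to [v_m]. *)
have Wy : N = 2%N -> gspan m.+2 d (y (v m)).
  by move=> N2; apply: Wop (gspan_y low Wv) _; rewrite dE; lia.
have Wy1 : N = 3%N -> gspan m.+2 d (y1 (v m)).
  by move=> N3; apply: Wop (gspan_y1 low Wv) _; rewrite dE; lia.
have Wh : N = 4%N -> gspan m.+2 d (h (v m)).
  by move=> N4; apply: Wop (gspan_h low Wv) _; rewrite dE; lia.
have Wx : N = 5%N -> gspan m.+2 d (x (v m)).
  by move=> N5; apply: Wop (gspan_x Wv) _; rewrite dE; lia.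
have Wxx : N = 6%N -> gspan m.+2 d (x (x (v m))).
  by move=> N6'; apply: Wop (gspan_x (gspan_x Wv)) _; rewrite dE; lia.
case: N N6 WN @d @T WT Wz dE Wop Wy Wy1 Wh Wx Wxx =>
  [|[|[|[|[|[|[|]]]]]]] // _ WN d T WT Wz dE Wop Wy Wy1 Wh Wx Wxx.
- rewrite -v_odd; last by rewrite /= m_even.
  by apply: (@gspang _ _ _ _ _ m.+2 0) => //; rewrite depthS_even depthSS_even; lia.
(* Here and in the next cases the scalar collects the factors [coef_even j * zsign K i (j - 2)] of
   all quadratic terms, weighted as in the relation. *)
- apply: (@gspan_scale _ _ _ _ _ (2 * (k + 4) / (k + 1))).
    by rewrite ?oppr_eq0 !(mulf_eq0, invr_eq0, negb_or)
      ?k0 ?k1 ?k2 ?k3 ?k4 ?kp ?pnatr_eq0.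
  have -> : (2 * (k + 4) / (k + 1)) *: z 1 (v m.+1) =
      (6 * t * (2 * lam + 1)) *: z 0 (v m)
      - 3 *: (T 0%N 3%N - T 3%N 0%N) - 2 *: (T 1%N 2%N - T 2%N 1%N).
    by rewrite /T; use (1 : K) (r21 (v m)); module_eq;
      rewrite /coef_even /=; field; rewrite ?k0 ?k1.
  by gspan_combine;
    first [exact: WT | exact: Wz | exact: Wy | exact: Wy1 | exact: Wh | exact: Wx | exact: Wxx].
- apply: (@gspan_scale _ _ _ _ _ (- (2 / (k + 1)))).
    by rewrite ?oppr_eq0 !(mulf_eq0, invr_eq0, negb_or)
      ?k0 ?k1 ?k2 ?k3 ?k4 ?kp ?pnatr_eq0.
  have -> : (- (2 / (k + 1))) *: z 2 (v m.+1) =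
      (2 * t ^+ 2 * (lam - 1) * (lam + 2)) *: y (v m) +
      (2 * t * (2 * lam + 1)) *: z 1 (v m) - (T 1%N 3%N - T 3%N 1%N).
    by rewrite /T; use (1 : K) (r22 (v m)); module_eq;
      rewrite /coef_even /=; field; rewrite ?k0 ?k1.
  by gspan_combine;
    first [exact: WT | exact: Wz | exact: Wy | exact: Wy1 | exact: Wh | exact: Wx | exact: Wxx].
- apply: (@gspan_scale _ _ _ _ _ (- ((k + 3) / (k + 1)))).
    by rewrite ?oppr_eq0 !(mulf_eq0, invr_eq0, negb_or)
      ?k0 ?k1 ?k2 ?k3 ?k4 ?kp ?pnatr_eq0.
  have -> : (- ((k + 3) / (k + 1))) *: z 3 (v m.+1) =
      (2 * t ^+ 2 * (lam - 1) * (lam + 2)) *: y1 (v m) +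
      (2 * t * (2 * lam + 1)) *: z 2 (v m)
      - (T 2%N 3%N - T 3%N 2%N) - (T 1%N 4%N - T 4%N 1%N).
    by rewrite /T; use (1 : K) (r22_1 (v m)); module_eq;
      rewrite /coef_even /=; field; rewrite ?k0 ?k1.
  by gspan_combine;
    first [exact: WT | exact: Wz | exact: Wy | exact: Wy1 | exact: Wh | exact: Wx | exact: Wxx].
- apply: (@gspan_scale _ _ _ _ _ (4 / (k * (k + 1)))).
    by rewrite ?oppr_eq0 !(mulf_eq0, invr_eq0, negb_or)
      ?k0 ?k1 ?k2 ?k3 ?k4 ?kp ?pnatr_eq0.
  have -> : (4 / (k * (k + 1))) *: z 4 (v m.+1) =
      (2 * t ^+ 2 * (lam - 1) * (lam + 2)) *: h (v m) +
      (2 * t * (2 * lam + 1)) *: z 3 (v m) - (T 1%N 5%N - T 5%N 1%N).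
    by rewrite /T; use (1 : K) (r22_2 (v m)); module_eq;
      rewrite /coef_even /=; field; rewrite ?k0 ?k1.
  by gspan_combine;
    first [exact: WT | exact: Wz | exact: Wy | exact: Wy1 | exact: Wh | exact: Wx | exact: Wxx].
- apply: (@gspan_scale _ _ _ _ _ (- ((k + 2) * (k - 1) / (k * (k + 1))))).
    by rewrite ?oppr_eq0 !(mulf_eq0, invr_eq0, negb_or)
      ?k0 ?k1 ?k2 ?k3 ?k4 ?kp ?pnatr_eq0.
  have -> : (- ((k + 2) * (k - 1) / (k * (k + 1)))) *: z 5 (v m.+1) =
      (2 * t ^+ 2 * (lam - 1) * (lam + 2)) *: x (v m) +
      (2 * t * (2 * lam + 1)) *: z 4 (v m) - (T 2%N 5%N - T 5%N 2%N) - (T 1%N 6%N - T 6%N 1%N).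
    by rewrite /T; use (1 : K) (r22_3 (v m)); module_eq;
      rewrite /coef_even /=; field; rewrite ?k0 ?k1.
  by gspan_combine;
    first [exact: WT | exact: Wz | exact: Wy | exact: Wy1 | exact: Wh | exact: Wx | exact: Wxx].
- apply: (@gspan_scale _ _ _ _ _ (2 * (k + 2) / (k * (k + 1)))).
    by rewrite ?oppr_eq0 !(mulf_eq0, invr_eq0, negb_or)
      ?k0 ?k1 ?k2 ?k3 ?k4 ?kp ?pnatr_eq0.
  have -> : (2 * (k + 2) / (k * (k + 1))) *: z 6 (v m.+1) =
      (4 * t ^+ 2 * (lam - 1) * (lam + 2)) *: x (x (v m)) +
      (2 * t * (2 * lam + 1)) *: z 5 (v m) - (T 3%N 5%N - T 5%N 3%N).
    by rewrite /T; use (1 : K) (r22_4 (v m)); module_eq;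
      rewrite /coef_even /=; field; rewrite ?k0 ?k1.
  by gspan_combine;
    first [exact: WT | exact: Wz | exact: Wy | exact: Wy1 | exact: Wh | exact: Wx | exact: Wxx].
Qed.

Lemma zclosed_even : zclosed m.+1.
Proof.
move=> N; have [N6|N7] := leqP N 6; last by rewrite z_ge7 //; apply: gspan0.
elim/ltn_ind: N N6 => N IHN N6; apply: z_odd_lt => // l lN.
by apply: IHN => //; apply: ltnW; apply: leq_trans N6.
Qed.

Let zc1 j : (j <= m.+1)%N -> zclosed j.
Proof. by rewrite leq_eqVlt => /predU1P[->|/zc//]; exact: zclosed_even. Qed.

Let odd_mS : odd m.+1.
Proof. by rewrite /= m_even. Qed.

(* Here [Z_i, v_{m+1}] = b_i X^i v_{m+2} modulo lower strings, with b_0 = 1. *)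
Definition coef_odd (i : nat) : K :=
  match i with
  | 0 => 1
  | 1 | 2 => 3 / (k + 4)
  | 3 | 4 => 6 / ((k + 4) * (k + 3))
  | 5 | 6 => 6 / ((k + 4) * (k + 3) * (k + 2))
  | _ => 0
  end.

Lemma zv_odd i :
  gspan m.+1 ((depth m.+1)%:Z + 3 - i%:Z) (z i (v m.+1) - coef_odd i *: xn i (v m.+2)).
Proof.
have k2 := depth_neq0 2; have k3 := depth_neq0 3; have k4 := depth_neq0 4.
have dS : (depth m.+2)%:R = k + 4 by rewrite depthSS_even natrD.
have next j : dcoef 3 j.+1 * coef_odd j = coef_odd j.+1 * dcoef (k + 4) j.+1 ->
    dcoef (k + 4) j.+1 != 0 ->
    gspan m.+1 ((depth m.+1)%:Z + 3 - j%:Z) (z j (v m.+1) - coef_odd j *: xn j (v m.+2)) ->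
    gspan m.+1 ((depth m.+1)%:Z + 3 - j.+1%:Z) (z j.+1 (v m.+1) - coef_odd j.+1 *: xn j.+1 (v m.+2)).
  move=> cEq dn0 Wj.
  have dE : (depth m.+1)%:Z + 3 - j.+1%:Z = (depth m.+1)%:Z + 3 - j%:Z - 1 by lia.
  rewrite dE; apply: (@coef_next m.+1 _ j j (coef_odd j) (coef_odd j.+1)) => //.
  - by case: lowest_even.
  - by rewrite depthS_even depthSS_even; lia.
  - by rewrite -dE; apply: zclosed_even.
  - by rewrite dS.
  - by rewrite dS.
have W0 : gspan m.+1 ((depth m.+1)%:Z + 3 - 0%:Z) (z 0 (v m.+1) - coef_odd 0 *: xn 0 (v m.+2)).
  by rewrite [xn 0 _]/= scale1r -v_odd // subrr; apply: gspan0.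
have dc3 : dcoef (k + 4) 3 = k + 3 by rewrite /dcoef /=; ring.
have dc5 : dcoef (k + 4) 5 = k + 2 by rewrite /dcoef /=; ring.
have W1 : gspan m.+1 ((depth m.+1)%:Z + 3 - 1%:Z) (z 1 (v m.+1) - coef_odd 1 *: xn 1 (v m.+2)).
  by apply: next W0; rewrite /dcoef /= ?subr0 //; field.
have W2 : gspan m.+1 ((depth m.+1)%:Z + 3 - 2%:Z) (z 2 (v m.+1) - coef_odd 2 *: xn 2 (v m.+2)).
  by apply: next W1; rewrite /dcoef /= ?oppr_eq0 ?oner_eq0 //; field.
have W3 : gspan m.+1 ((depth m.+1)%:Z + 3 - 3%:Z) (z 3 (v m.+1) - coef_odd 3 *: xn 3 (v m.+2)).
  apply: next W2; rewrite dc3 //.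
  by rewrite /dcoef /=; field; rewrite k3 k4.
have W4 : gspan m.+1 ((depth m.+1)%:Z + 3 - 4%:Z) (z 4 (v m.+1) - coef_odd 4 *: xn 4 (v m.+2)).
  by apply: next W3; rewrite /dcoef /= ?oppr_eq0 ?pnatr_eq0 //; field; rewrite k3 k4.
have W5 : gspan m.+1 ((depth m.+1)%:Z + 3 - 5%:Z) (z 5 (v m.+1) - coef_odd 5 *: xn 5 (v m.+2)).
  apply: next W4; rewrite dc5 //.
  by rewrite /dcoef /=; field; rewrite k2 k3 k4.
have W6 : gspan m.+1 ((depth m.+1)%:Z + 3 - 6%:Z) (z 6 (v m.+1) - coef_odd 6 *: xn 6 (v m.+2)).
  by apply: next W5; rewrite /dcoef /= ?oppr_eq0 ?pnatr_eq0 //; field; rewrite k2 k3 k4.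
case: i => [|[|[|[|[|[|[|i]]]]]]] //.
by rewrite z_ge7 // scale0r subr0; apply: gspan0.
Qed.

(* Relation (3.1) applied to [x u] and [x (x u)], where u = v m: the two
   resulting equations and the coefficients of [z 3 u], [z 1 (z 2 u)] force
   [z 1 (z 0 (z 2 u))] to be a multiple of itself by a factor different from 1. *)
Lemma z01_even : z 0 (v m.+2) = 0 /\ z 1 (v m.+2) = 0.
Proof.
have k1 := depth_neq0 1; have k4 := depth_neq0 4; have k6 := depth_neq0 6.
have wE := v_odd odd_mS; have uE := v_even m_even.
have a1 : z 0 (x (v m)) = 0.
  by use (1 : K) (xz 0 (v m)); rewrite z0v z1v ad0; module_eq; ring.
have a2 : z 1 (x (v m)) = - v m.+1.
  by rewrite uE; use (-1 : K) (xz 1 (v m)); rewrite z1v ad0; module_eq; ring.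
have a3 : z 2 (x (v m)) = z 3 (v m) - x (v m.+1).
  by rewrite uE; use (1 : K) (xz 2 (v m)); module_eq; ring.
have a4 : z 0 (x (x (v m))) = - v m.+1.
  by use (1 : K) (xz 0 (x (v m))); rewrite a1 a2 ad0; module_eq; ring.
have a5 : z 1 (x (x (v m))) = - z 3 (v m).
  by use (-1 : K) (xz 1 (x (v m))); rewrite a2 a3 adN; module_eq; ring.
have w0 : z 0 (v m.+2) = 0.
  rewrite wE; have := r31 (x (v m)); rewrite a1 a2 !adE => e1.
  by use (1 : K) e1; module_eq; ring.
have w1 : z 1 (v m.+2) = z 0 (z 0 (z 3 (v m))).
  rewrite wE; have := r31 (x (x (v m))); rewrite a4 a5 !adE => e1.
  by use (-1 : K) e1; module_eq; ring.
(* The degree is exactly [depth m], where the lower strings contribute only multiples of [v_m]. *)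
have [a z3E] : exists a, z 3 (v m) - coef_even 3 *: x (v m.+1) = a *: v m.
  apply: gspan_eq; have := zv_even 3; congr gspan; lia.
(* The degree exceeds [depth m.+1], so the congruence of [zv_odd] is an equality. *)
have z1E : z 1 (v m.+1) = coef_odd 1 *: x (v m.+2).
  apply/subr0_eq; apply: (gspan_gt (zv_odd 1)); lia.
have b1 : z 0 (x (v m.+1)) = z 1 (v m.+1) - x (v m.+2).
  by rewrite wE; use (1 : K) (xz 0 (v m.+1)); module_eq; ring.
have b2 : z 0 (x (v m.+2)) = z 1 (v m.+2).
  by use (1 : K) (xz 0 (v m.+2)); rewrite w0 ad0; module_eq; ring.
have z3E' : z 3 (v m) = coef_even 3 *: x (v m.+1) + a *: v m by rewrite -z3E addrC subrK.
split=> //; apply/eqP.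
have : (1 - coef_even 3 * (coef_odd 1 - 1)) *: z 1 (v m.+2) = 0.
  use (1 : K) w1; rewrite z3E' !(adE, z0v, b1, z1E, b2).
  by module_eq; ring.
move/eqP; rewrite scaler_eq0 => /orP[|//].
have -> : 1 - coef_even 3 * (coef_odd 1 - 1) = (k + 6) / (k + 4) by rewrite /=; field; rewrite k1 k4.
by rewrite mulf_eq0 invr_eq0 (negbTE k4) (negbTE k6).
Qed.

(** Same method with offset 0, so the total index is [N]: [r21], [r22], [r21_2], [r22_2] serve
    [N = 3, 4, 5, 6]. *)
Lemma z_even_lt N : (N <= 6)%N -> (2 < N)%N ->
  (forall l, (l < N)%N -> gspan m.+3 ((depth m.+2)%:Z + 3 - l%:Z) (z l (v m.+2))) ->
  gspan m.+3 ((depth m.+2)%:Z + 3 - N%:Z) (z N (v m.+2)).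
Proof.
move=> N6 N2 WN.
have k0 := depth_neq0 0; rewrite addr0 in k0.
have k1 := depth_neq0 1; have k2 := depth_neq0 2; have k3 := depth_neq0 3.
have k4 := depth_neq0 4; have k5 := depth_neq0 5; have k6 := depth_neq0 6.
pose d := (depth m.+2)%:Z + 3 - N%:Z.
pose T i j := z i (z j (v m.+1)) - (coef_odd j * zsign K i (j - 0)) *: z N (v m.+2).
have WT i j : (i + j = N)%N -> gspan m.+3 d (T i j).
  move=> ij; apply: (@zz_mod m.+1 0 coef_odd i j N low2 zc1) => //.
  - by rewrite depthS_even depthSS_even; lia.
  - by move=> l; rewrite subn0; exact: zv_odd.
  - by rewrite addn0.
have Wz i : (i + 3 = N)%N -> gspan m.+3 d (z i (v m.+1)).
  move=> iN; have := gspan_le (leqnSn _) (zclosed_even i); congr gspan.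
  by rewrite /d depthSS_even depthS_even; lia.
have dE : d = (depth m.+1)%:Z + 6 - N%:Z by rewrite /d depthSS_even depthS_even; lia.
have Wv : gspan m.+1 (depth m.+1)%:Z (v m.+1) by apply: (@gspang _ _ _ _ _ m.+1 0); lia.
have Wop e d' : gspan m.+1 d' e -> d' = d -> gspan m.+3 d e.
  by move=> We <-; apply: gspan_le We; rewrite -addn2 leq_addr.
have Wy : N = 4%N -> gspan m.+3 d (y (v m.+1)).
  by move=> N4; apply: Wop (gspan_y low1 Wv) _; rewrite dE; lia.
have Wh : N = 6%N -> gspan m.+3 d (h (v m.+1)).
  by move=> N4; apply: Wop (gspan_h low1 Wv) _; rewrite dE; lia.
have Wy1 : N = 5%N -> gspan m.+3 d (y1 (v m.+1)).
  by move=> N4; apply: Wop (gspan_y1 low1 Wv) _; rewrite dE; lia.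
case: N N6 N2 WN @d @T WT Wz dE Wop Wy Wh Wy1 =>
  [|[|[|[|[|[|[|]]]]]]] // _ _ WN d T WT Wz dE Wop Wy Wh Wy1.
- apply: (@gspan_scale _ _ _ _ _ (- (3 * (k + 5) * (k + 6) / ((k + 4) * (k + 3))))).
    by rewrite ?oppr_eq0 !(mulf_eq0, invr_eq0, negb_or)
      ?k0 ?k1 ?k2 ?k3 ?k4 ?k5 ?k6 ?pnatr_eq0.
  have -> : (- (3 * (k + 5) * (k + 6) / ((k + 4) * (k + 3)))) *: z 3 (v m.+2) =
      (6 * t * (2 * lam + 1)) *: z 0 (v m.+1)
      - 3 *: (T 0%N 3%N - T 3%N 0%N) - 2 *: (T 1%N 2%N - T 2%N 1%N).
    by rewrite /T; use (1 : K) (r21 (v m.+1)); module_eq;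
      rewrite /coef_odd /=; field; rewrite ?k2 ?k3 ?k4.
  by gspan_combine;
    first [exact: WT | exact: Wz | exact: Wy | exact: Wy1 | exact: Wh].
- apply: (@gspan_scale _ _ _ _ _ (3 * (k + 5) / ((k + 4) * (k + 3)))).
    by rewrite ?oppr_eq0 !(mulf_eq0, invr_eq0, negb_or)
      ?k0 ?k1 ?k2 ?k3 ?k4 ?k5 ?k6 ?pnatr_eq0.
  have -> : (3 * (k + 5) / ((k + 4) * (k + 3))) *: z 4 (v m.+2) =
      (2 * t ^+ 2 * (lam - 1) * (lam + 2)) *: y (v m.+1) +
      (2 * t * (2 * lam + 1)) *: z 1 (v m.+1) - (T 1%N 3%N - T 3%N 1%N).
    by rewrite /T; use (1 : K) (r22 (v m.+1)); module_eq;
      rewrite /coef_odd /=; field; rewrite ?k2 ?k3 ?k4.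
  by gspan_combine;
    first [exact: WT | exact: Wz | exact: Wy | exact: Wy1 | exact: Wh].
- apply: (@gspan_scale _ _ _ _ _ (- (3 * (k + 5) * (k + 1) / ((k + 3) * (k + 2))))).
    by rewrite ?oppr_eq0 !(mulf_eq0, invr_eq0, negb_or)
      ?k0 ?k1 ?k2 ?k3 ?k4 ?k5 ?k6 ?pnatr_eq0.
  have -> : (- (3 * (k + 5) * (k + 1) / ((k + 3) * (k + 2)))) *: z 5 (v m.+2) =
      (6 * t * (2 * lam + 1)) *: z 2 (v m.+1) - (T 2%N 3%N - T 3%N 2%N)
      - 2 *: (T 1%N 4%N - T 4%N 1%N) - 3 *: (T 0%N 5%N - T 5%N 0%N).
    by rewrite /T; use (1 : K) (r21_2 (v m.+1)); module_eq;
      rewrite /coef_odd /=; field; rewrite ?k2 ?k3 ?k4.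
  by gspan_combine;
    first [exact: WT | exact: Wz | exact: Wy | exact: Wy1 | exact: Wh].
- apply: (@gspan_scale _ _ _ _ _ (3 * (k + 1) / ((k + 3) * (k + 2)))).
    by rewrite ?oppr_eq0 !(mulf_eq0, invr_eq0, negb_or)
      ?k0 ?k1 ?k2 ?k3 ?k4 ?k5 ?k6 ?pnatr_eq0.
  have -> : (3 * (k + 1) / ((k + 3) * (k + 2))) *: z 6 (v m.+2) =
      (2 * t ^+ 2 * (lam - 1) * (lam + 2)) *: h (v m.+1) +
      (2 * t * (2 * lam + 1)) *: z 3 (v m.+1) - (T 1%N 5%N - T 5%N 1%N).
    by rewrite /T; use (1 : K) (r22_2 (v m.+1)); module_eq;
      rewrite /coef_odd /=; field; rewrite ?k2 ?k3 ?k4.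
  by gspan_combine;
    first [exact: WT | exact: Wz | exact: Wy | exact: Wy1 | exact: Wh].
Qed.

Lemma zclosed_evenS : zclosed m.+2.
Proof.
have [w0 w1] := z01_even.
move=> N; have [N6|N7] := leqP N 6; last by rewrite z_ge7 //; apply: gspan0.
elim/ltn_ind: N N6 => N IHN N6; have [N2|N2] := ltnP 2 N.
  apply: z_even_lt => // l lN.
  by apply: IHN => //; apply: ltnW; apply: leq_trans N6.
case: N N2 {IHN N6} => [|[|[|//]]] _; rewrite ?w0 ?w1; try exact: gspan0.
rewrite -v_even; last by rewrite /= negbK.
apply: (@gspang _ _ _ _ _ m.+3 0) => //.
by rewrite /depth /= !negbK (negbTE m_even); lia.
Qed.

End EvenStep.
(** Up to sign this is [[Y, Z_i]], and [Y] acts as the square of [Y_1], which descends the string of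
    [Z] by two. For [i < 2] the product of coefficients is zero, so the truncated exponent does no
    harm. *)
Lemma v_base i : z i (v 0) = - (dcoef 3 i * dcoef 3 i.-1) *: xn (i - 2) (el tZ).
Proof.
have y1Z : y1 (el tZ) = 0.
  rewrite ad_el; have := relator_el lam t (isT : 4 < 10)%N.
  by cbn [nth relators]; rewrite lcomb_tm.
have hZ : h (el tZ) = 3 *: el tZ.
  have := relator_el lam t (isT : 6 < 10)%N.
  by cbn [nth relators]; rewrite lcombB lcombZ !lcomb_tm ad_el => /subr0_eq.
have elZ n : el (Zi n) = xn n (el tZ) by elim: n => //= n <-; rewrite ad_el.
rewrite ad_el el_antisym /sgn andbF scale1r -ad_el elZ -y1y1.
rewrite !(y1_iter _ y1Z hZ) adZ (y1_iter _ y1Z hZ) scalerA scaleNr.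
by rewrite subn2.
Qed.

Lemma straightening_base : [/\ lowest 0, zclosed 0, z 0 (v 0) = 0 & z 1 (v 0) = 0].
Proof.
have Z3 : 3 *: el tZ = v 1.
  by rewrite v_even // v_base subnn /dcoef /=; module_eq; ring.
have ZE : el tZ = 3^-1 *: v 1 by rewrite -Z3 scalerA mulVf ?scale1r // pnatr_eq0.
have Zn n : xn n (el tZ) = 3^-1 *: xn n (v 1).
  by elim: n => //= n ->; rewrite adZ.
have z0v : z 0 (v 0) = 0 by rewrite v_base dcoef0 mul0r oppr0 scale0r.
have z1v : z 1 (v 0) = 0 by rewrite v_base dcoef0 mulr0 oppr0 scale0r.
split=> //.
  split.
    rewrite ad_el el_antisym.
    have := relator_el lam t (isT : 0 < 10)%N.
    by cbn [nth relators]; rewrite lcomb_tm => ->; rewrite scaler0 oppr0.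
  rewrite ad_el; have := relator_el lam t (isT : 1 < 10)%N.
  by cbn [nth relators]; rewrite lcombB lcombZ !lcomb_tm => /subr0_eq.
case=> [|[|i]]; rewrite ?z0v ?z1v; try exact: gspan0.
rewrite v_base Zn; do 2!apply: gspanZ; apply: gspang => //.
by rewrite subn2 /depth /=; lia.
Qed.

(** The two vanishing brackets are carried along because the next step takes them as hypotheses. *)
Lemma straightening_even n : let m := n.*2 in
  [/\ forall j, (j <= m)%N -> lowest j, forall j, (j <= m)%N -> zclosed j,
     z 0 (v m) = 0 & z 1 (v m) = 0].
Proof.
elim: n => [|n [low zc z0v z1v]].
  have [low0 zc0 z00 z10] := straightening_base.
  by split=> // j; rewrite leqn0 => /eqP->.
rewrite /= doubleS.
have n_even : ~~ odd n.*2 by rewrite odd_double.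
have [w0 w1] := z01_even n_even low zc z0v z1v; split=> // j.
  rewrite leq_eqVlt => /predU1P[->|]; first exact: lowest_evenS.
  by rewrite ltnS leq_eqVlt => /predU1P[->|/low//]; exact: lowest_even.
rewrite leq_eqVlt => /predU1P[->|]; first exact: zclosed_evenS.
by rewrite ltnS leq_eqVlt => /predU1P[->|/zc//]; exact: zclosed_even.
Qed.

Lemma lowest_v m : lowest m.
Proof. by have [low _ _ _] := straightening_even m; apply: low; lia. Qed.

Lemma zclosed_v m : zclosed m.
Proof. by have [_ zc _ _] := straightening_even m; apply: zc; lia. Qed.

End Straightening.

(** * Spanning *)

Section Spanning.
Variables (K : numFieldType) (lam t : K).
Local Notation L := (L lam t).
Local Notation x := (@ad _ lam t tX).
Local Notation y := (@ad _ lam t tY).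
Local Notation y1 := (@ad _ lam t (Yi 1)).
Local Notation h := (@ad _ lam t (Yi 2)).
Local Notation z i := (@ad _ lam t (Zi i)).
Local Notation el := (@el _ lam t).
Local Notation v m := (el (vtree m)).
Local Notation xn n := (iter n (@ad _ lam t tX)).
Local Notation gspan := (@gspan _ lam t).
Implicit Types (e : L) (d : int).

Lemma iter_ad0 s n : iter n (ad s) 0 = 0 :> L.
Proof. by elim: n => //= n ->; rewrite ad0. Qed.

Lemma iter_adD s n e f : iter n (ad s) (e + f) = iter n (ad s) e + iter n (ad s) f.
Proof. by elim: n => //= n ->; rewrite adD. Qed.

Lemma iter_adZ s n c e : iter n (ad s) (c *: e) = c *: iter n (ad s) e.
Proof. by elim: n => //= n ->; rewrite adZ. Qed.

(** * Local nilpotency of ad X and length of the strings *)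

Definition xnil e := exists n, xn n e = 0.

Lemma xnilD e f : xnil e -> xnil f -> xnil (e + f).
Proof.
move=> [a ea] [b fb]; exists (a + b)%N; rewrite iter_adD !iterD fb iter_ad0 addr0.
by rewrite -iterD addnC iterD ea iter_ad0.
Qed.

Lemma xnilZ c e : xnil e -> xnil (c *: e).
Proof. by move=> [a ea]; exists a; rewrite iter_adZ ea scaler0. Qed.

Lemma xnil_x e : xnil (x e) -> xnil e.
Proof. by move=> [a ea]; exists a.+1; rewrite iterSr. Qed.

(** Double induction, on the nilpotency exponent of [e] and on the distance from [i] to 7:
    [x (z i e)] is a combination of [z i.+1 e] and [z i (x e)], both covered by induction. *)
Lemma xnil_z i e : xnil e -> xnil (z i e).
Proof.
move=> [n]; elim: n e i => [|n IHn] e i en; first by rewrite /= in en; exists 0%N; rewrite en /= ad0.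
have [j ij] : exists j, (7 <= i + j)%N by exists 7; rewrite leq_addl.
elim: j i ij => [|j IHj] i ij.
  by exists 0%N; rewrite /= z_ge7 //; lia.
apply: xnil_x; rewrite xz -scaleNr; apply: xnilD; first by apply: IHj; lia.
by apply/xnilZ/IHn; rewrite -iterSr.
Qed.

Lemma elX : el tX = xn 3 (v 0).
Proof.
have := relator_el lam t (isT : 2 < 10)%N; cbn [nth relators].
rewrite lcombD !lcomb_tm => e1.
have -> : xn 3 (v 0) = el (Br tX (Yi 2)) by rewrite /= !ad_el.
rewrite el_antisym (_ : sgn _ _ _ = 1) // scale1r.
by use (1 : K) e1; module_eq; ring.
Qed.

(** By [elX] the vector [X^5 Y] is [[X, [X, X]]], and antisymmetry with Jacobi gives three times it
    as zero. *)
Lemma xnil_v0 : xnil (v 0).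
Proof.
exists 5%N; rewrite -[5%N]/(2 + 3)%N iterD -elX /= !ad_el.
have e1 := el_antisym lam t (Br tX tX) tX.
rewrite -!ad_el ad_br !ad_el /sgn /= in e1.
by use (3^-1 : K) e1; module_eq; field.
Qed.

Lemma xnil_v m : xnil (v m).
Proof.
elim: m => [|m IHm]; first exact: xnil_v0.
by have [/v_odd->|/v_even->] := boolP (odd m); apply: xnil_z.
Qed.

Lemma dcoef_eq0 k n : (dcoef k%:R n == 0 :> K) = (n == 0)%N || (n == k.*2.+1)%N.
Proof.
rewrite /dcoef; case: ifP => on.
  rewrite subr_eq0 eqr_nat; apply/eqP/orP => [->|[/eqP n0|/eqP ->]].
  - by right; apply/eqP; lia.
  - by rewrite n0 in on.
  - by lia.
rewrite oppr_eq0 pnatr_eq0; lia.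
Qed.

(** Start from some vanishing power of [X] and descend: [Y_1] maps [X^(N+1) v_m] to a multiple of
    [X^N v_m], and by [dcoef_eq0] the factor is nonzero as long as [N] exceeds twice the depth. *)
Lemma xn_v m n : ((depth m).*2 < n)%N -> xn n (v m) = 0.
Proof.
move=> mn; have [N] := xnil_v m.
elim: N => [|N IHN]; first by move=> /= v0; rewrite v0 iter_ad0.
have [Nn|nN] := ltnP N n.
  by move=> xN; rewrite -(subnK Nn) iterD xN iter_ad0.
move=> xN; apply: IHN.
have := y1_xn N.+1 (lowest_v lam t m); rewrite xN ad0 => /esym/eqP.
rewrite scaler_eq0 dcoef_eq0 /= => /orP[|/eqP//]; lia.
Qed.

Inductive Span : L -> Prop :=
  | Span0 : Span 0
  | SpanZ c e : Span e -> Span (c *: e)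
  | SpanD e f : Span e -> Span f -> Span (e + f)
  | Spang j n : Span (xn n (v j)).

Lemma gspan_Span m d e : gspan m d e -> Span e.
Proof.
elim=> {d e} [d|d c e _|d e f _ We _|d j n _ _].
- exact: Span0.
- exact: SpanZ.
- exact: SpanD.
- exact: Spang.
Qed.

Lemma Span_gspan (P : L -> L) : {morph P : e f / e + f} -> (forall c e, P (c *: e) = c *: P e) ->
  (forall m d e, gspan m d e -> exists d', gspan m.+1 d' (P e)) ->
  forall e, Span e -> Span (P e).
Proof.
move=> PD PZ PW e; elim=> {e} [|c e _|e f _ We _|j n].
- by rewrite -[X in P X](scale0r (0 : L)) PZ scale0r; apply: Span0.
- by rewrite PZ; apply: SpanZ.
- by rewrite PD; apply: SpanD.
- have [d W] := PW j _ _ (@gspang _ _ _ _ _ j n (leqnn _) erefl).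
  exact: gspan_Span W.
Qed.

(** Jacobi reduces a compound monomial to the three generators, each of which respects the
    filtration by strings. *)
Lemma ad_Span s e : Span e -> Span (ad s e).
Proof.
elim: s e => [g|a IHa b IHb] e; last first.
  move=> We; rewrite ad_br -scaleNr; apply: SpanD; first exact/IHa/IHb.
  by apply/SpanZ/IHb/IHa.
have low m j : (j <= m)%N -> lowest lam t j by move=> _; exact: lowest_v.
have zc m j : (j <= m)%N -> zclosed lam t j by move=> _; exact: zclosed_v.
case: g; apply: Span_gspan; try by [exact: adD|exact: adZ]; move=> m d f Wf.
- by exists (d - 1); apply: gspan_le (leqnSn m) (gspan_x Wf).
- by exists (d + 2); apply: gspan_le (leqnSn m) (gspan_y (low m) Wf).
- by exists (d + 3 - 0%:Z); apply: (gspan_z 0 (zc m) Wf).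
Qed.

Lemma el_Span s : Span (el s).
Proof.
elim: s => [[]|a _ b IHb].
- by rewrite elX; apply: Spang.
- exact: (Spang 0 0).
- have -> : el (Gen gZ) = 3^-1 *: v 1.
    have -> : v 1 = z 2 (v 0) by rewrite v_even.
    by rewrite v_base subnn /dcoef /= -[Gen gZ]/tZ; module_eq; field.
  by apply: SpanZ; apply: (Spang 1 0).
- by rewrite -ad_el; apply: ad_Span.
Qed.

Lemma L_Span e : Span e.
Proof.
elim/L_ind: e => [|c s e We]; first exact: Span0.
by apply: SpanD => //; apply: SpanZ; apply: el_Span.
Qed.

End Spanning.

(** * Soundness of the evaluation *)

Section Evaluation.
Variables (K : fieldType) (lam t : K).
Local Notation V := ({poly K} * {poly K})%type.
Implicit Types w : V.

Lemma ev_br a b w : ev lam t (Br a b) w =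
  ev lam t a (ev lam t b w) - sgn K a b *: ev lam t b (ev lam t a w).
Proof. by rewrite -scaleN1r. Qed.

Lemma evl_lcomb u w : evl lam t u w = lcomb (fun s => ev lam t s w : V) u.
Proof.
by rewrite /lcomb; elim: u => [|p u IHu] /=; rewrite ?big_nil ?big_cons -?IHu.
Qed.

Lemma ev_linear s c v w : ev lam t s (c *: v + w : V) = c *: ev lam t s v + ev lam t s w.
Proof.
elim: s v w c => [[]|a IHa b IHb] v w c.
- congr pair; rewrite /= ?derivD ?derivZ -?mul_polyC; ring.
- by congr pair; rewrite /= derivD derivZ.
- congr pair; rewrite /= !(derivD, derivZ) -?mul_polyC; ring.
rewrite !ev_br IHb IHa (IHa v) IHb; congr pair; rewrite /= -?mul_polyC; ring.
Qed.

Lemma evZ s c v : ev lam t s (c *: v : V) = c *: ev lam t s v.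
Proof.
have ev0 : ev lam t s (0 : V) = 0.
  by have := ev_linear s (-1) 0 0; rewrite scaler0 addr0 scaleN1r addNr.
by have := ev_linear s c v 0; rewrite !addr0 ev0 addr0.
Qed.

Lemma ev0 s : ev lam t s (0 : V) = 0.
Proof. by have := evZ s 0 0; rewrite !scale0r. Qed.

Lemma ev_subZ s c v w : ev lam t s (v - c *: w : V) = ev lam t s v - c *: ev lam t s w.
Proof. by rewrite -scaleNr addrC ev_linear scaleNr addrC. Qed.

Lemma ev_lcomb s (F : tree -> V) u :
  ev lam t s (lcomb F u) = lcomb (fun r => ev lam t s (F r) : V) u.
Proof.
elim: u => [|p u IHu]; first by rewrite !lcomb_nil ev0.
by rewrite !lcomb_cons ev_linear IHu.
Qed.

(** * Closed forms of the operators and verification of the relators *)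

Lemma ev_Z0 w : ev lam t (Zi 0) w = (t *: w.2^`(), - (t *: w.1^`()^`())).
Proof. by []. Qed.

Ltac ev_tac := congr pair; rewrite /= /sgn /= ?(derivE, derivZ, derivM) -?mul_polyC; ring.

Lemma ev_Z1 w : ev lam t (Zi 1) w =
  ((t * (1 - lam)) *: w.1^`(),
   (t * (- 2 - lam)) *: w.2^`()).
Proof. by rewrite [LHS]ev_br !ev_Z0; ev_tac. Qed.

Lemma ev_Z2 w : ev lam t (Zi 2) w =
  ((t * (- 3)) *: ('X * w.2^`()) + (t * (- 1 + lam)) *: w.2,
   (t * (3)) *: ('X * w.1^`()^`()) + (t * (2 - 2 * lam)) *: w.1^`()).
Proof. by rewrite [LHS]ev_br !ev_Z1; ev_tac. Qed.

Lemma ev_Z3 w : ev lam t (Zi 3) w =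
  ((t * (- 2 + 2 * lam)) *: ('X * w.1^`()) + (t * (lam - lam ^+ 2)) *: w.1,
   (t * (4 + 2 * lam)) *: ('X * w.2^`()) + (t * (2 - lam - lam ^+ 2)) *: w.2).
Proof. by rewrite [LHS]ev_br !ev_Z2; ev_tac. Qed.

Lemma ev_Z4 w : ev lam t (Zi 4) w =
  ((t * (6)) *: ('X^2 * w.2^`()) + (t * (4 - 4 * lam)) *: ('X * w.2),
   (t * (- 6)) *: ('X^2 * w.1^`()^`()) + (t * (- 8 + 8 * lam)) *: ('X * w.1^`()) +
   (t * (2 * lam - 2 * lam ^+ 2)) *: w.1).
Proof. by rewrite [LHS]ev_br !ev_Z3; ev_tac. Qed.

Lemma ev_Z5 w : ev lam t (Zi 5) w =
  ((t * (2 - 2 * lam)) *: ('X^2 * w.1^`()) + (t * (- 2 * lam + 2 * lam ^+ 2)) *: ('X * w.1),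
   (t * (- 4 - 2 * lam)) *: ('X^2 * w.2^`()) + (t * (- 4 + 2 * lam + 2 * lam ^+ 2)) *: ('X * w.2)).
Proof. by rewrite [LHS]ev_br !ev_Z4; ev_tac. Qed.

Lemma ev_Z6 w : ev lam t (Zi 6) w =
  ((t * (- 6)) *: ('X^3 * w.2^`()) + (t * (- 6 + 6 * lam)) *: ('X^2 * w.2),
   (t * (6)) *: ('X^3 * w.1^`()^`()) + (t * (12 - 12 * lam)) *: ('X^2 * w.1^`()) +
   (t * (- 6 * lam + 6 * lam ^+ 2)) *: ('X * w.1)).
Proof. by rewrite [LHS]ev_br !ev_Z5; ev_tac. Qed.

Lemma ev_Y1 w : ev lam t (Yi 1) w = (- w.2, - w.1^`()).
Proof. by rewrite [LHS]ev_br; ev_tac. Qed.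

Lemma ev_Y2 w : ev lam t (Yi 2) w =
  ((- 2) *: ('X * w.1^`()) + lam *: w.1, (- 2) *: ('X * w.2^`()) + (lam - 1) *: w.2).
Proof. by rewrite [LHS]ev_br !ev_Y1; ev_tac. Qed.

Lemma ev_relator i w : (i < size (relators lam t))%N ->
  lcomb (fun s => ev lam t s w : V) (nth [::] (relators lam t) i) = 0.
Proof.
case: i => [|[|[|[|[|[|[|[|[|[|//]]]]]]]]]] _; cbn [nth relators];
  rewrite ?(lcombB, lcombD, lcombZ, lcomb_tm).
- by rewrite [LHS]ev_br !ev_Y1; ev_tac.
- by rewrite ev_br !ev_Y2; ev_tac.
- by rewrite ev_br !ev_Y2; ev_tac.
- by rewrite [LHS]ev_br; ev_tac.
- by rewrite [LHS]ev_br !ev_Y1; ev_tac.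
- by rewrite [LHS]ev_br !ev_Z6; ev_tac.
- by rewrite ev_br !ev_Y2; ev_tac.
- by rewrite (ev_br tZ) (ev_br (Zi 1)) !(ev_Z1, ev_Z2, ev_Z3); ev_tac.
- by rewrite (ev_br (Zi 1)) !(ev_Z1, ev_Z3); ev_tac.
- by rewrite (ev_br (Zi 1)) !ev_Z1 !(ev_br tZ tZ); ev_tac.
Qed.

(* Evaluations of inhomogeneous combinations are split by conjugation with the
   parity involution theta -> - theta. *)
Definition parity w : V := (w.1, - w.2).

Lemma parityZ c w : parity (c *: w) = c *: parity w.
Proof. by rewrite /parity /= -scalerN. Qed.

Lemma parity_lcomb (F : tree -> V) u :
  parity (lcomb F u) = lcomb (fun s => parity (F s)) u.
Proof.
elim: u => [|p u IHu]; first by rewrite !lcomb_nil /parity oppr0.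
rewrite !lcomb_cons -IHu -parityZ; congr pair; exact: opprD.
Qed.

Lemma parityK : involutive parity.
Proof. by move=> [f g]; rewrite /parity /= opprK. Qed.

Lemma ev_parity s w : ev lam t s (parity w) = (-1) ^+ par s *: parity (ev lam t s w).
Proof.
elim: s w => [[]|a IHa b IHb] w.
- by congr pair; rewrite /= ?(derivE, derivZ, derivM) -?mul_polyC; ring.
- by congr pair; rewrite /= ?(derivE, derivZ, derivM) -?mul_polyC; ring.
- by congr pair; rewrite /= ?(derivE, derivZ, derivM) -?mul_polyC; ring.
rewrite !ev_br IHb evZ IHa IHa evZ IHb [par (Br a b)]/= /parity.
by case: (par a) (par b) => -[]; congr pair; rewrite /= -?mul_polyC; ring.
Qed.

(** Bracketing an inhomogeneous [u] with an odd monomial puts a different sign on its even and odd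
    terms. Conjugation by [parity] produces exactly these signs, so the signed sum vanishes too. *)
Lemma lcomb_sign (b : bool) u w : (forall w, lcomb (fun s => ev lam t s w : V) u = 0) ->
  lcomb (fun s => (if b && par s then -1 else 1) *: ev lam t s w : V) u = 0.
Proof.
case: b => u0; last by under [LHS]eq_bigr do rewrite scale1r; exact: u0.
transitivity (parity (lcomb (fun s => ev lam t s (parity w) : V) u)).
  rewrite parity_lcomb; apply: eq_bigr => p _; congr (_ *: _).
  by rewrite ev_parity parityZ parityK; case: (par p.2).
by rewrite u0 /parity oppr0.
Qed.

Lemma ev_InI u w : InI lam t u -> lcomb (fun s => ev lam t s w : V) u = 0.
Proof.
move=> ui; elim: ui w => {u} [a b|a b c|i /ev_relator //|u v _ IHu _ IHv|c u _ IHu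
    |s u _ IHu|s u _ IHu|u v _ IHu uv] w.
- rewrite /antisym lcombD lcombZ !lcomb_brl !lcomb_tm !ev_br /sgn (andbC (par b)).
  by case: ifP => _; congr pair; rewrite /= -?mul_polyC; ring.
- rewrite /jacobi !lcombB lcombZ lcomb_brr !lcomb_brl !lcomb_tm !ev_br /sgn /=.
  rewrite !ev_subZ.
  by case: (par a) (par b) (par c) => [] [] [] /=; module_eq; ring.
- by rewrite lcombD IHu IHv addr0.
- by rewrite lcombZ IHu scaler0.
- rewrite lcomb_brl.
  transitivity (ev lam t s (lcomb (fun r => ev lam t r w : V) u) - lcomb (fun r =>
    (if par s && par r then -1 else 1) *: ev lam t r (ev lam t s w) : V) u).
    rewrite ev_lcomb /lcomb -sumrB; apply: eq_bigr => p _.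
    by rewrite ev_br scalerBr /sgn.
  by rewrite IHu ev0 lcomb_sign // subr0.
- rewrite lcomb_brr.
  transitivity (lcomb (fun r => ev lam t r (ev lam t s w) : V) u - ev lam t s (lcomb (fun r =>
    (if par s && par r then -1 else 1) *: ev lam t r w : V) u)).
    rewrite ev_lcomb /lcomb -sumrB; apply: eq_bigr => p _.
    by rewrite ev_br scalerBr /sgn andbC evZ.
  by rewrite IHu lcomb_sign // ev0 subr0.
- by rewrite -(eq_lcomb _ uv) IHu.
Qed.

End Evaluation.

(** * Faithfulness *)

Section Faithfulness.
Variables (K : numFieldType) (lam t : K).
Hypothesis t_neq0 : t != 0.
Local Notation V := ({poly K} * {poly K})%type.
Local Notation L := (L lam t).
Local Notation x := (@ad _ lam t tX).
Local Notation y1 := (@ad _ lam t (Yi 1)).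
Local Notation el := (@el _ lam t).
Local Notation v m := (el (vtree m)).
Local Notation xn n := (iter n (@ad _ lam t tX)).
Implicit Types (e : L) (w : V).

Lemma par_vtree m : par (vtree m) = odd m.
Proof. by elim: m => //= m IHm; case: ifP => om /=; rewrite IHm om. Qed.

Lemma derivn_mulX (p : {poly K}) n :
  ('X * p)^`(n.+1) = 'X * p^`(n.+1) + n.+1%:R *: p^`(n).
Proof.
elim: n => [|n IHn]; first by rewrite !derivn1 derivM derivX mul1r addrC scale1r.
rewrite [LHS]derivnS IHn derivD derivZ derivM derivX -!derivnS -[n.+2%:R]natr1.
by rewrite scalerDl scale1r mul1r; ring.
Qed.

Local Arguments derivn : simpl never.

(* The power of d_theta - theta d_x, up to sign, of exponent [depth m]. *)
Definition lowest_op (m : nat) w : V :=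
  if odd m then (w.2^`(m), - w.1^`(m.+1)) else (w.1^`(m.+1), w.2^`(m.+1)).

(** Each step multiplies the constant by [-2 t] or by [3 t (m + 1)], nonzero because [t] is and the
    characteristic is 0. *)
Lemma ev_vtree m : exists2 c, c != 0 & forall w, ev lam t (vtree m) w = c *: lowest_op m w.
Proof.
elim: m => [|m [c c0 IHm]]; first by exists 1 => [|w]; rewrite ?oner_neq0 ?scale1r.
have parv := par_vtree m; move: IHm; rewrite /lowest_op [odd m.+1]/= [vtree m.+1]/=.
case: ifP => om IHm; rewrite [~~ _]/=.
  exists (- 2 * t * c) => [|w]; first by rewrite !mulf_neq0 // oppr_eq0 pnatr_eq0.
  rewrite ev_br !IHm /sgn parv om.
  congr pair; rewrite /= !(derivZ, derivnN, derivN, derivnZ) -?derivnS -?derivSn -!mul_polyC; ring.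
exists (3 * t * m.+1%:R * c) => [|w]; first by rewrite !mulf_neq0 // pnatr_eq0.
rewrite ev_br !IHm /sgn parv om andbF !ev_Z2.
congr pair; rewrite /= !(derivZ, derivnD, derivnZ, derivn_mulX) -?derivnS -?derivSn -!mul_polyC; ring.
Qed.

Definition evL e w : V := lcomb (fun s => ev lam t s w : V) (repr e).

Lemma evL_cls u w : evL (cls lam t u) w = lcomb (fun s => ev lam t s w : V) u.
Proof.
apply/eqP; rewrite -subr_eq0 -lcombB; apply/eqP/ev_InI; exact: repr_cls.
Qed.

Definition ker e := forall w, evL e w = 0.

Lemma ker_ad s e : ker e -> ker (ad s e).
Proof.
move=> ke w; rewrite /ad evL_cls lcomb_brl.
transitivity (ev lam t s (lcomb (fun r => ev lam t r w : V) (repr e)) - lcomb (fun r =>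
  (if par s && par r then -1 else 1) *: ev lam t r (ev lam t s w) : V) (repr e)).
  rewrite ev_lcomb /lcomb -sumrB; apply: eq_bigr => p _.
  by rewrite ev_br scalerBr /sgn.
by rewrite -/(evL e w) ke ev0 lcomb_sign // subr0.
Qed.

Lemma ker_iter s n e : ker e -> ker (iter n (ad s) e).
Proof. by move=> ke; elim: n => //= n; apply: ker_ad. Qed.

Lemma evLD e f w : evL (e + f) w = evL e w + evL f w.
Proof. by rewrite -[e]cls_repr -[f]cls_repr -clsD !evL_cls lcombD. Qed.

Lemma evLZ c e w : evL (c *: e) w = c *: evL e w.
Proof. by rewrite -[e]cls_repr -clsZ !evL_cls lcombZ. Qed.

Lemma evL_el s w : evL (el s) w = ev lam t s w.
Proof. by rewrite evL_cls lcomb_tm. Qed.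

Lemma evL_sum (I : Type) (r : seq I) (F : I -> L) w :
  evL (\sum_(i <- r) F i) w = \sum_(i <- r) evL (F i) w.
Proof.
elim: r => [|i r IHr]; rewrite ?big_nil ?big_cons ?evLD ?IHr //.
by have := evLZ 0 0 w; rewrite !scale0r.
Qed.

(** Triangularity: the test vector [w] for [j] is a monomial of the smallest degree not killed by
    the operator of [v_j]. Later operators differentiate it too often, and earlier coefficients
    vanish by induction. *)
Lemma ker_lowest M (a : nat -> K) : ker (\sum_(j < M) a j *: v j) ->
  forall j, (j < M)%N -> a j = 0.
Proof.
move=> ka j; elim/ltn_ind: j => j IHj jM.
pose w : V := if odd j then (0, 'X^j) else ('X^(j.+1), 0).
have := ka w; rewrite evL_sum (bigD1 (Ordinal jM)) //= big1 => [|i ij].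
  rewrite addr0 evLZ evL_el; have [c c0 ->] := ev_vtree j.
  rewrite /lowest_op /w; case: (odd j) => /=.
    move=> [/(congr1 (fun p : {poly K} => p`_0)) + _].
    rewrite derivnXn subnn ffactnn expr0 !coefZ coefMn coef1 coef0 /=.
    move/eqP; rewrite !mulf_eq0 (negbTE c0) pnatr_eq0.
    by rewrite eqn0Ngt fact_gt0 orbF => /eqP.
  move=> [/(congr1 (fun p : {poly K} => p`_0)) + _].
  rewrite derivnXn subnn ffactnn expr0 !coefZ coefMn coef1 coef0 /=.
  move/eqP; rewrite !mulf_eq0 (negbTE c0) pnatr_eq0.
  by rewrite eqn0Ngt fact_gt0 orbF => /eqP.
rewrite evLZ evL_el; have [ji|ij'] := ltnP j i; last first.
  have ij2 : (i < j)%N by rewrite ltn_neqAle ij' andbT -val_eqE in ij *.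
  by rewrite IHj ?scale0r.
have [c c0 ->] := ev_vtree i.
suff -> : lowest_op i w = 0 by rewrite !scaler0.
have dX n p : (p < n)%N -> ('X^p : {poly K})^`(n) = 0.
  by move=> pn; rewrite derivnXn ffact_small ?mulr0n.
rewrite /lowest_op /w; case: (odd i) (odd j) => -[] /=;
  by rewrite ?derivnC ?derivn0 ?dX ?linear0 ?oppr0 ?if_same //; lia.
Qed.

Lemma y1_iter_xn m n N : (n <= N)%N -> iter N y1 (xn n (v m)) =
  (if n == N then \prod_(1 <= i < N.+1) dcoef (depth m)%:R i else 0) *: v m.
Proof.
elim: N n => [|N IHN] n.
  by rewrite leqn0 => /eqP->; rewrite big_geq // scale1r.
rewrite leq_eqVlt => /predU1P[->|].
  rewrite eqxx iterSr y1_xn; last exact: lowest_v.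
  by rewrite iter_adZ IHN // eqxx scalerA [in RHS]big_nat_recr //= mulrC.
rewrite ltnS => nN; rewrite ltn_eqF ?ltnS // iterS IHN //.
by case: eqP => _; rewrite adZ (proj1 (lowest_v lam t m)) ?scaler0 ?scale0r.
Qed.

(** Induction on the bound for the powers of [X]: [Y_1^N] leaves only the terms with exponent [N],
    scaled by [p j], and these are independent by [ker_lowest]. *)
Lemma ker_sum N M (c : nat -> nat -> K) :
  ker (\sum_(j < M) \sum_(n < N) c j n *: xn n (v j)) ->
  \sum_(j < M) \sum_(n < N) c j n *: xn n (v j) = 0.
Proof.
elim: N => [|N IHN]; first by move=> _; rewrite big1 // => j _; rewrite big_ord0.
pose p j := \prod_(1 <= i < N.+1) dcoef (depth j)%:R i : K.
move=> ke.
have : ker (\sum_(j < M) (c j N * p j) *: v j).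
  have -> : \sum_(j < M) (c j N * p j) *: v j =
      iter N y1 (\sum_(j < M) \sum_(n < N.+1) c j n *: xn n (v j)).
    rewrite (big_morph _ (iter_adD _ _) (iter_ad0 _ _ _ _)); apply: eq_bigr => j _.
    rewrite (big_morph _ (iter_adD _ _) (iter_ad0 _ _ _ _)) big_ord_recr /= big1 ?add0r => [|n _].
      by rewrite iter_adZ y1_iter_xn // eqxx scalerA.
    by rewrite iter_adZ y1_iter_xn ?ltn_eqF ?scale0r ?scaler0 // ltnW.
  exact: ker_iter.
move/(ker_lowest (a := fun j => c j N * p j)) => cp.
(* If [p j] is zero, then [N] exceeds twice the depth of [v_j] and the vector [X^N v_j] vanishes
   instead of its coefficient. *)
have cx (j : 'I_M) : c j N *: xn N (v j) = 0.
  have /eqP := cp j (ltn_ord j); rewrite mulf_eq0 => /orP[/eqP->|]; first by rewrite scale0r.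
  rewrite prodf_seq_eq0 => /seq.hasP[i /=]; rewrite mem_index_iota dcoef_eq0 => iN iE.
  by rewrite xn_v ?scaler0 //; lia.
have eE : \sum_(j < M) \sum_(n < N.+1) c j n *: xn n (v j) =
    \sum_(j < M) \sum_(n < N) c j n *: xn n (v j).
  by apply: eq_bigr => j _; rewrite big_ord_recr /= cx addr0.
by rewrite eE in ke *; apply: IHN.
Qed.

Lemma Span_sum e : Span e -> exists N M (c : nat -> nat -> K),
  e = \sum_(j < M) \sum_(n < N) c j n *: xn n (v j).
Proof.
suff sub : Span e -> exists (s : seq (K * (nat * nat))),
    e = \sum_(p <- s) p.1 *: xn p.2.2 (v p.2.1).
  move=> /sub[s ->].
  pose N := (\max_(p <- s) p.2.2).+1; pose M := (\max_(p <- s) p.2.1).+1.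
  exists N, M, (fun j n => \sum_(p <- s | p.2 == (j, n)) p.1).
  have bnd p : p \in s -> (p.2.1 < M)%N /\ (p.2.2 < N)%N.
    by move=> ps; rewrite !ltnS; split;
      [apply: (leq_bigmax_seq (F := fun p => p.2.1))|apply: (leq_bigmax_seq (F := fun p => p.2.2))].
  under [RHS]eq_bigr do under eq_bigr do rewrite scaler_suml.
  rewrite pair_big /= (exchange_big_dep predT) //= big_seq [RHS]big_seq.
  apply: eq_bigr => -[a [j n]] /bnd [/= jM nN].
  by rewrite (big_pred1 (Ordinal jM, Ordinal nN)).
elim=> {e} [|c e _ [s ->]|e f _ [s ->] _ [r ->]|j n].
- by exists [::]; rewrite big_nil.
- exists [seq (c * p.1, p.2) | p <- s]; rewrite big_map scaler_sumr.
  by apply: eq_bigr => p _; rewrite scalerA.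
- by exists (s ++ r); rewrite big_cat.
- by exists [:: (1, (j, n))]; rewrite big_seq1 scale1r.
Qed.

Lemma ker_eq0 e : ker e -> e = 0.
Proof. by have [N [M [c ->]]] := Span_sum (L_Span e); apply: ker_sum. Qed.

End Faithfulness.

(** Surjectivity onto the generated subsuperalgebra is built into its definition, so the content is
    the kernel, described on formal combinations modulo the super-Lie axioms and the relators. *)
Theorem theorem4p3 (R : realType) (lam t : R[i])
  (hlam : forall z : int, lam != z%:~R) (ht : t != 0) :
  forall u : fa R[i],
    (forall v : V R[i], evl lam t u v = vzero R[i]) <-> InI lam t u.
Proof.
move=> u; split=> [u0|ui w]; last by rewrite evl_lcomb ev_InI.
apply/cls_eq0/(ker_eq0 ht) => w.
by rewrite evL_cls -evl_lcomb u0.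
Qed.
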